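(* Let $\mathcal F^U$ be a class of distributions of $Y$ on $[0,1]$ all of whose members satisfy the regularity conditions (a)–(e) listed in the context with common constants $C_0,C^*,\overline C$. Let $\mathit{data}_Y=\{Y_i\}_{i=1}^n$ be $n$ i.i.d. draws from $F_Y$, and let $\hat p_U=\hat p_U(\mathit{data}_Y)$ be the uniform empirical revenue maximization price defined in the context. Then there is a constant $C<\infty$ independent of $n$ such that for all $n$ $$\sup_{F_Y\in\mathcal F^U}\Big(R(p_U^*,F_Y)-\mathbb E_{F_Y}\big[R(\hat p_U(\mathit{data}_Y),F_Y)\big]\Big)\le C\,n^{-2/3},$$ where $\mathbb E_{F_Y}$ is the expectation over $\mathit{data}_Y\sim F_Y$.
   Context: $Y\in[0,1]$ has CDF $F_Y$ and density $f_Y$ on $[0,1]$. For a price $p\in[0,1]$, $R(p,F_Y)=p(1-F_Y(p))$, and $p_U^*=p_U^*(F_Y)$ maximizes $R(\cdot,F_Y)$ over $[0,1]$. Regularity conditions, with constants $C_0,C^*,\overline C\in(0,\infty)$: (a) $|f_Y(y)-f_Y(y')|\le C_0|y-y'|$ for all $y,y'\in[0,1]$. (b) $y\mapsto y(1-F_Y(y))$ is strictly concave with second derivative $-2f_Y(y)-yf_Y'(y)\le-C^*$ for almost every $y$. (c) $|2f_Y(y)+yf_Y'(y)|\le\overline C$ for almost every $y$. (d) $p_U^*(F_Y)\in(0,1)$. (e) $f_Y$ is continuously differentiable in a neighborhood of $p_U^*(F_Y)$. Uniform ERM price: $\hat p_U(\mathit{data}_Y)$ is a (measurable choice of) maximizer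 over $p\in[0,1]$ of the empirical revenue $p\cdot\frac1n|\{i:Y_i\ge p\}|$. *)

(* Defs.v *)
From HB Require Import structures.
From mathcomp Require Export all_boot all_order all_algebra.
From mathcomp Require Export all_classical all_reals all_analysis.
Set Implicit Arguments.
Unset Strict Implicit.
Unset Printing Implicit Defensive.
Export Order.TTheory GRing.Theory Num.Theory.
Export numFieldNormedType.Exports.
Local Open Scope classical_set_scope.
Local Open Scope ring_scope.

(* Law of n i.i.d. draws from F, i.e. the n-fold product of F, on n-tuples;
   [iid_law_box] below is its characterization. *)
Section iid_law.
Context d (T : measurableType d) (R : realType) (F : probability T R).

Definition cons_sample n (z : T * n.-tuple T) : n.+1.-tuple T :=
  [tuple of z.1 :: z.2].

Lemma measurable_cons_sample n :
  measurable_fun [set: T * n.-tuple T] (@cons_sample n).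
Proof. by apply: measurable_cons. Qed.

HB.instance Definition _ n :=
  @isMeasurableFun.Build _ _ _ _ (@cons_sample n) (@measurable_cons_sample n).

Fixpoint iid_law n : probability (n.-tuple T) R :=
  match n with
  | 0%N => \d_ ([tuple] : 0.-tuple T)
  | m.+1 => distribution (F \x iid_law m)%E (@cons_sample m)
  end.

Lemma iid_law_box n (A : 'I_n -> set T) : (forall i, measurable (A i)) ->
  (iid_law n [set x | forall i, A i (tnth x i)] = \prod_(i < n) F (A i))%E.
Proof.
elim: n A => [|n IHn] A mA.
  rewrite big_ord0 /= diracE mem_set//= => -[]//.
rewrite big_ord_recl -(IHn (fun i => A (lift ord0 i)))//.
rewrite -product_measure1E//=.
- rewrite /pushforward; congr (_ _); apply/seteqP; split=> -[x t] /= H.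
    split; first by have := H ord0.
    by move=> i; have := H (lift ord0 i); rewrite tnthS.
  move=> i; case: (unliftP ord0 i) => [j ->|->]; last by case: H.
  by rewrite tnthS; case: H.
rewrite (_ : [set _ | _] = \bigcap_(i in [set: 'I_n])
    ((@tnth _ T ^~ i) @^-1` A (lift ord0 i))); last first.
  by apply/seteqP; split=> x /= H i; [move=> _; exact: H|exact: H].
apply: fin_bigcap_measurable => // i _.
by rewrite -[X in measurable X]setTI; exact: measurable_tnth.
Qed.

End iid_law.

Section pricing.
Context (R : realType).
Implicit Types (F : probability (measurableTypeR R) R) (f : R -> R) (p : R).

(* F is concentrated on [0, 1]: F is a probability measure, so taking A to be
   the whole line forces the integral of f over [0, 1] to be 1. *)
Definition has_density01 F f : Prop :=
  [/\ measurable_fun (`[0, 1]%classic : set (measurableTypeR R)) f,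
      forall y : R, y \in `[0, 1] -> 0 <= f y &
      forall A : set (measurableTypeR R), measurable A ->
        F A = (\int[lebesgue_measure]_(y in A `&` `[0%R, 1%R]) (f y)%:E)%E].

Definition cdf_of F (y : R) : R := fine (F `]-oo, y]%classic).

Definition revenue F p : R := p * (1 - cdf_of F p).

Definition empirical_revenue n (y : n.-tuple R) p : R :=
  p * (n%:R^-1 * #|[pred i : 'I_n | p <= tnth y i]|%:R).

Definition maximizes01 (g : R -> R) p : Prop :=
  p \in `[0, 1] /\ forall q : R, q \in `[0, 1] -> g q <= g p.

Definition strictly_concave01 (g : R -> R) : Prop :=
  forall x y t : R, x \in `[0, 1] -> y \in `[0, 1] -> x != y -> t \in `]0, 1[ ->
    t * g x + (1 - t) * g y < g (t * x + (1 - t) * y).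

(* Only the values of f on [0, 1] matter: the derivatives of f are taken at
   almost every point of [0, 1] or at points close to pU, which lies in ]0, 1[.
   A Lipschitz f is differentiable almost everywhere, so [derivable] only keeps
   derive1 f from denoting a default value; the second derivative of
   y |-> y (1 - F(y)) is - 2 f(y) - y f'(y). *)
Record regular (C0 Cstar Cbar : R) F f (pU : R) : Prop := Regular {
  regular_lipschitz : forall y y' : R, y \in `[0, 1] -> y' \in `[0, 1] ->
    `|f y - f y'| <= C0 * `|y - y'| ;
  regular_strictly_concave : strictly_concave01 (revenue F) ;
  regular_derivative2_le :
    {ae lebesgue_measure, forall y : R, y \in `[0, 1] ->
      derivable f y 1 /\ - (2 * f y) - y * derive1 f y <= - Cstar} ;
  regular_derivative2_bounded :
    {ae lebesgue_measure, forall y : R, y \in `[0, 1] ->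
      `|2 * f y + y * derive1 f y| <= Cbar} ;
  regular_interior : pU \in `]0, 1[ ;
  regular_C1 :
    \forall y \near pU, derivable f y 1 /\ {for y, continuous (derive1 f)} }.

Definition erm_price n (phat : n.-tuple (measurableTypeR R) -> R) : Prop :=
  measurable_fun [set: n.-tuple (measurableTypeR R)] phat /\
  forall y : n.-tuple R, (forall i, tnth y i \in `[0, 1]) ->
    maximizes01 (empirical_revenue y) (phat y).

End pricing.

(* Main.v *)
Require Import Defs.
From mathcomp Require Import measurable_realfun ring lra.
Set Implicit Arguments.
Unset Strict Implicit.
Unset Printing Implicit Defensive.
Local Open Scope classical_set_scope.
Local Open Scope ring_scope.

(** Let G be the regret of the empirical price p, Z = |p - pU| and r = n^(-1/3).
    The Taylor estimates for the revenue give (Cstar / 2) Z^2 <= G <= L Z^2, so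
    only the event Z > r matters.  Optimality of p for the empirical revenue
    bounds G by Z |A| + |X(p)|, where A and X(p) are the deviations of the
    empirical measure from F on [pU, oo[ and on the interval between pU and p.
    Dividing G^2 <= (Z |A| + |X(p)|)^2 by G >= (Cstar / 2) Z^2 yields
    G <= C (A^2 + sup_p X(p)^2 / Z^2), so no peeling over shells is needed: it
    is enough that the expectation of sup_(Z > r) X^2 / Z^2 is O(1 / (n r)).
    On the grid pU +- k r^2, X(k) / F(D_k), with D_k the complement of the k-th
    interval, is a martingale in k; Doob's L^2 inequality, applied to the
    martingale whose increments are multiplied by F(D_k) / (k r^2 + r), gives
    the bound, since the sum over k of r^2 / (k r^2 + r)^2 is at most 1 / r.
    Finally 1 / (n r) = r^2 = n^(-2/3). *)

(** * A weighted maximal inequality for multinomial counts *)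

Section running_max.
Context {R : realFieldType}.
Implicit Types f : nat -> R.

Fixpoint running_max f k : R :=
  if k is j.+1 then Num.max (running_max f j) (f j.+1) else f 0%N.

Lemma le_running_max f j k : (j <= k)%N -> f j <= running_max f k.
Proof.
elim: k => [|k IH]; first by rewrite leqn0 => /eqP ->.
rewrite leq_eqVlt ltnS /= le_max => /orP[/eqP ->|/IH ->//].
by rewrite lexx orbT.
Qed.

(** Deterministic form of Doob's L^2 inequality: the sum is a discrete stochastic integral of the
    running maximum, so it has mean zero when [f] is a martingale. With S the running maximum and
    Sum that integral, induction on [k] gives S^2 - 2 S f + 2 Sum <= 0, and (S - 2 f)^2 >= 0 then
    absorbs the cross term. *)
Lemma doob_pathwise f k : f 0%N = 0 ->
  running_max f k ^+ 2 <=
  4 * f k ^+ 2 - 4 * \sum_(j < k) running_max f j * (f j.+1 - f j).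
Proof.
move=> f0; suff : running_max f k ^+ 2 - 2 * running_max f k * f k
    + 2 * (\sum_(j < k) running_max f j * (f j.+1 - f j)) <= 0.
  have := sqr_ge0 (running_max f k - 2 * f k); nra.
elim: k => [|k IH]; first by rewrite big_ord0 /= f0; lra.
rewrite big_ord_recr /= maxEle; case: ifP => _; last by nra.
have := sqr_ge0 (f k.+1 - running_max f k); nra.
Qed.

(** With u, v the running maxima of [f] and [- f], the 8 comes from (2 (u + v))^2 <= 8 (u^2 +
    v^2). *)
Definition max_sqr f k : R :=
  8 * (running_max f k ^+ 2 + running_max (\- f) k ^+ 2).

Lemma max_sqr_ge0 f k : 0 <= max_sqr f k.
Proof. by rewrite mulr_ge0// addr_ge0// sqr_ge0. Qed.

(** Passes from a weighted martingale [f] back to the sequence [y] that it drives. The difference y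
    - f at j+1 equals a (y - f) - (1 - a) f at j, a convex combination of two numbers in [-B, B], so
    it never leaves [-B, B] and |y| <= 2 B. *)
Lemma contraction_le_max_sqr f (y a : nat -> R) k : f 0%N = 0 -> y 0%N = 0 ->
  (forall j, 0 <= a j <= 1) ->
  (forall j, y j.+1 = a j * y j + (f j.+1 - f j)) ->
  forall j, (j <= k)%N -> y j ^+ 2 <= max_sqr f k.
Proof.
move=> f0 y0 a01 yS.
have p0 : 0 <= running_max f k by rewrite -f0 le_running_max.
have m0 : 0 <= running_max (\- f) k.
  by have := @le_running_max (\- f) 0 k isT; rewrite /= f0 oppr0.
set B := running_max f k + running_max (\- f) k.
have fB j : (j <= k)%N -> - B <= f j <= B.
  move=> jk; have := le_running_max f jk; have := le_running_max (\- f) jk.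
  by rewrite /= /B; lra.
have yB j : (j <= k)%N -> - B <= y j - f j <= B.
  elim: j => [|j IH] jk; first by rewrite y0 f0 /B; lra.
  rewrite yS; have := IH (ltnW jk); have := fB _ (ltnW jk); have := a01 j.
  rewrite (_ : a j * y j + _ - _ = a j * (y j - f j) - (1 - a j) * f j); last by ring.
  nra.
move=> j jk; have := fB _ jk; have := yB _ jk => H1 H2.
have : y j ^+ 2 <= (2 * B) ^+ 2.
  by rewrite -subr_ge0 subr_sqr mulr_ge0//; lra.
move/le_trans; apply; rewrite /max_sqr /B.
have := sqr_ge0 (running_max f k - running_max (\- f) k); nra.
Qed.

End running_max.

(** * Expectations under a finite product distribution *)

Section product_weights.
Context {R : realFieldType} {I : finType} {n : nat}.
Variable pi : I -> R.
Hypothesis pi_sum : \sum_j pi j = 1.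
Implicit Types (a : {ffun 'I_n -> I}) (phi : {ffun 'I_n -> I} -> R).

Definition prod_sum phi : R :=
  \sum_(a : {ffun 'I_n -> I}) (\prod_i pi (a i)) * phi a.

Definition update a i j : {ffun 'I_n -> I} :=
  [ffun l => if l == i then j else a l].

Lemma update_same a i j : update a i j i = j.
Proof. by rewrite ffunE eqxx. Qed.

Lemma update_other a i j l : l != i -> update a i j l = a l.
Proof. by rewrite ffunE => /negPf ->. Qed.

(** Redrawing one coordinate independently preserves the product law. *)
Lemma prod_sum_resample phi i :
  prod_sum phi = prod_sum (fun a => \sum_j pi j * phi (update a i j)).
Proof.
have -> : prod_sum phi =
    \sum_(z : {ffun 'I_n -> I} * I)
      (\prod_l pi (z.1 l) * pi z.2) * phi z.1.
  rewrite -(pair_bigA _ (fun a j => (\prod_l pi (a l) * pi j) * phi a)) /=.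
  apply: eq_bigr => a _; rewrite -mulr_suml -mulr_sumr pi_sum mulr1//.
(* Exchanging coordinate [i] with the extra draw is an involution that preserves the weight of the
   n+1 draws. *)
pose h (z : {ffun 'I_n -> I} * I) := (update z.1 i z.2, z.1 i).
have hK : involutive h.
  move=> [a j]; rewrite /h /= update_same; congr pair.
  by apply/ffunP => l; rewrite !ffunE; case: eqP => // ->.
rewrite (reindex_inj (inv_inj hK)) /=.
rewrite -(pair_bigA _ (fun a j => (\prod_l pi (update a i j l) * pi (a i))
                                  * phi (update a i j))) /=.
apply: eq_bigr => a _; rewrite mulr_sumr; apply: eq_bigr => j _.
rewrite mulrA; congr (_ * _).
rewrite (bigD1 i)//= update_same [in RHS](bigD1 i)//=.
rewrite (eq_bigr (fun l => pi (a l))) => [|l li]; last by rewrite update_other.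
ring.
Qed.

(** Finite substitute for conditioning: with all other coordinates frozen, [phi] is constant where
    [psi] lives, so it factors out of the mean of [psi] over coordinate [i]. *)
Lemma prod_sum_orthogonal phi (psi : I -> R) (D : pred I) i :
  (forall j, ~~ D j -> psi j = 0) -> \sum_j pi j * psi j = 0 ->
  (forall a j j', D j -> D j' -> phi (update a i j) = phi (update a i j')) ->
  prod_sum (fun a => phi a * psi (a i)) = 0.
Proof.
move=> psiD psi0 phiD; rewrite (prod_sum_resample _ i) /prod_sum big1// => a _.
rewrite (_ : \sum_j _ = 0) ?mulr0//.
case: (pickP D) => [j0 Dj0|D0]; last first.
  by apply: big1 => j _; rewrite update_same psiD ?mulr0// D0.
transitivity (phi (update a i j0) * \sum_j pi j * psi j); last by rewrite psi0 mulr0.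
rewrite mulr_sumr; apply: eq_bigr => j _; rewrite update_same.
have [Dj|/psiD ->] := boolP (D j); last by rewrite !mulr0.
by rewrite (phiD _ _ _ Dj Dj0) mulrCA.
Qed.

Lemma prod_sumD phi phi' :
  prod_sum (fun a => phi a + phi' a) = prod_sum phi + prod_sum phi'.
Proof. by rewrite /prod_sum -big_split/=; apply: eq_bigr => a _; rewrite mulrDr. Qed.

Lemma prod_sumZ c phi : prod_sum (fun a => c * phi a) = c * prod_sum phi.
Proof. by rewrite /prod_sum mulr_sumr; apply: eq_bigr => a _; rewrite mulrCA. Qed.

Lemma prod_sum_sum (J : Type) (s : seq J) (phi : J -> {ffun 'I_n -> I} -> R) :
  prod_sum (fun a => \sum_(l <- s) phi l a) = \sum_(l <- s) prod_sum (phi l).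
Proof. by rewrite /prod_sum exchange_big/=; apply: eq_bigr => a _; rewrite mulr_sumr. Qed.

Lemma eq_prod_sum phi phi' : phi =1 phi' -> prod_sum phi = prod_sum phi'.
Proof. by move=> e; apply: eq_bigr => a _; rewrite e. Qed.

Lemma prod_sum1 : prod_sum (fun=> 1) = 1.
Proof.
rewrite /prod_sum; under eq_bigr do rewrite mulr1.
rewrite -(bigA_distr_bigA (fun=> pi)) /=.
by rewrite big1.
Qed.

Lemma prod_sum_coord (psi : I -> R) i :
  prod_sum (fun a => psi (a i)) = \sum_j pi j * psi j.
Proof.
rewrite (prod_sum_resample _ i) -[RHS]mulr1 -prod_sum1 -prod_sumZ.
apply: eq_prod_sum => a; rewrite mulr1; apply: eq_bigr => j _.
by rewrite update_same.
Qed.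

(** Variance of a sum of independent centered terms: the cross terms vanish by orthogonality. *)
Lemma prod_sum_sqr_sum (psi : I -> R) : \sum_j pi j * psi j = 0 ->
  prod_sum (fun a => (\sum_i psi (a i)) ^+ 2) =
  n%:R * \sum_j pi j * psi j ^+ 2.
Proof.
move=> psi0.
under eq_prod_sum do rewrite expr2 big_distrl.
rewrite prod_sum_sum/= (eq_bigr (fun=> \sum_j pi j * psi j ^+ 2)); last first.
  move=> i _; rewrite 
    (@eq_prod_sum _ (fun a => \sum_l psi (a i) * psi (a l))); last first.
    by move=> a; rewrite mulr_sumr.
  rewrite prod_sum_sum (bigD1 i)//= big1 => [|l li]; last first.
    apply: (@prod_sum_orthogonal (fun a => psi (a i)) psi predT l) => //.
    by move=> a j j' _ _; rewrite !update_other// eq_sym.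
  by rewrite addr0 (prod_sum_coord (fun c => psi c * psi c)).
by rewrite sumr_const card_ord -[LHS]mulr_natl.
Qed.

Hypothesis pi_ge0 : forall j, 0 <= pi j.

Lemma le_prod_sum phi phi' : (forall a, phi a <= phi' a) ->
  prod_sum phi <= prod_sum phi'.
Proof.
move=> le; apply: ler_sum => a _; apply: ler_wpM2l => //.
by apply: prodr_ge0 => i _.
Qed.

End product_weights.

(** * The weighted martingale of the cell counts *)

Section cell_martingale.
Context {R : realFieldType} {n K : nat}.
Variables (pi : 'I_K.+1 -> R) (sigma : nat -> R).
Hypothesis pi_sum : \sum_j pi j = 1.
Hypothesis pi_ge0 : forall j, 0 <= pi j.
Hypothesis sigma_gt0 : forall k, 0 < sigma k.
Hypothesis sigma_nd : forall k, sigma k <= sigma k.+1.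

Definition tail k : R := \sum_(c < K.+1) pi c * (k <= c)%:R.

Definition ratio k : R := tail k.+1 / tail k.

(* [1 - (k <= c)%:R / tail k] is a martingale in [k]; this is its increment
   multiplied by the weight [tail k.+1 / sigma k.+1]. *)
Definition increment k (c : 'I_K.+1) : R :=
  (ratio k * (k <= c)%:R - (k < c)%:R) / sigma k.+1.

Definition mart k (a : {ffun 'I_n -> 'I_K.+1}) : R :=
  \sum_(l < k) \sum_i increment l (a i).

(** Centered count of the samples in cells below [k]. When cells of index at least [k] make up the
    complement of an interval, this is the deviation of the count on the interval. *)
Definition tail_dev k (a : {ffun 'I_n -> 'I_K.+1}) : R :=
  \sum_i (tail k - (k <= a i)%:R).

Lemma tail0 : tail 0 = 1.
Proof. by rewrite -pi_sum; apply: eq_bigr => c _; rewrite mulr1. Qed.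

Lemma tail_ge0 k : 0 <= tail k.
Proof. by apply: sumr_ge0 => c _; rewrite mulr_ge0// ler0n. Qed.

Lemma tailS_le k : tail k.+1 <= tail k.
Proof.
apply: ler_sum => c _; rewrite ler_wpM2l// ler_nat.
by case: leqP => // /ltnW ->.
Qed.

(* The junk value [x / 0 = 0] is harmless: [tail k.+1] vanishes with [tail k]. *)
Lemma ratioK k : ratio k * tail k = tail k.+1.
Proof.
rewrite /ratio; have [t0|t0] := eqVneq (tail k) 0; last by rewrite divfK.
have := tailS_le k; have := tail_ge0 k.+1; rewrite t0 mulr0 => *.
by apply/eqP; rewrite eq_le; apply/andP.
Qed.

Lemma ratio01 k : 0 <= ratio k <= 1.
Proof.
rewrite /ratio; have [->|t0] := eqVneq (tail k) 0.
  by rewrite invr0 mulr0 lexx ler01.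
have tp : 0 < tail k by rewrite lt_def t0 tail_ge0.
by rewrite divr_ge0 ?tail_ge0//= ler_pdivrMr// mul1r tailS_le.
Qed.

Lemma increment_centered k : \sum_c pi c * increment k c = 0.
Proof.
rewrite (eq_bigr (fun c : 'I__ => (ratio k * (pi c * (k <= c)%:R)
    - pi c * (k < c)%:R) / sigma k.+1)) => [|c _]; last first.
  by rewrite /increment; ring.
by rewrite -mulr_suml sumrB -mulr_sumr ratioK subrr mul0r.
Qed.

(** By [ratioK] the second moment is exactly [ratio k * (tail k - tail k.+1)] over the squared
    weight, and [ratio k] is at most 1. *)
Lemma increment_sqr k :
  \sum_c pi c * increment k c ^+ 2 <= (tail k - tail k.+1) / sigma k.+1 ^+ 2.
Proof.
rewrite (eq_bigr (fun c : 'I__ => (ratio k ^+ 2 * (pi c * (k <= c)%:R)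
    + (1 - 2 * ratio k) * (pi c * (k < c)%:R)) / sigma k.+1 ^+ 2)) => [|c _]; last first.
  rewrite /increment expr_div_n.
  case: ltnP => [kc|ck]; first by rewrite (ltnW kc) /=; ring.
  by case: (k <= c)%N => /=; ring.
rewrite -mulr_suml ler_pM2r ?invr_gt0 ?exprn_gt0// big_split/= -!mulr_sumr.
have /andP[r0 r1] := ratio01 k; have := ratioK k; have := tailS_le k.
rewrite -[\sum_(i < _) pi i * (k <= i)%:R]/(tail k).
rewrite -[\sum_(i < _) pi i * (k < i)%:R]/(tail k.+1); nra.
Qed.

Lemma increment_update k (c c' : 'I_K.+1) : (k < c)%N -> (k < c')%N ->
  increment k c = increment k c'.
Proof. by move=> kc kc'; rewrite /increment kc kc' (ltnW kc) (ltnW kc'). Qed.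

(** Adaptedness: at time [k] the martingale cannot tell apart the cells of index at least [k]. *)
Lemma mart_update k a i (c c' : 'I_K.+1) : (k <= c)%N -> (k <= c')%N ->
  mart k (update a i c) = mart k (update a i c').
Proof.
move=> kc kc'; apply: eq_bigr => l _; apply: eq_bigr => j _.
rewrite !ffunE; case: eqP => // _; apply: increment_update.
  exact: leq_trans kc.
exact: leq_trans kc'.
Qed.

(** The martingale property, stated without a filtration: the hypothesis says that [phi] is known at
    time [k], while the increment vanishes on cells below [k] and is centered. *)
Lemma increment_orthogonal k (phi : {ffun 'I_n -> 'I_K.+1} -> R) :
  (forall a i (c c' : 'I_K.+1), (k <= c)%N -> (k <= c')%N ->
    phi (update a i c) = phi (update a i c')) ->
  prod_sum pi (fun a => phi a * \sum_i increment k (a i)) = 0.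
Proof.
move=> phik.
rewrite (@eq_prod_sum _ _ _ pi _ (fun a => \sum_i phi a * increment k (a i))); last first.
  by move=> a; rewrite mulr_sumr.
rewrite prod_sum_sum; apply: big1 => i _.
apply: (@prod_sum_orthogonal _ _ _ _ pi_sum phi (increment k)
  [pred c : 'I_K.+1 | k <= c]%N i).
- move=> c /=; rewrite -ltnNge => ck; rewrite /increment.
  by rewrite leqNgt ck/= ltnNge (ltnW ck) mulr0 subrr mul0r.
- exact: increment_centered.
- by move=> a c c' /= kc kc'; exact: phik.
Qed.

(** Orthogonal increments make second moments additive. *)
Lemma mart_sqr k : prod_sum pi (fun a => mart k a ^+ 2) <=
  n%:R * \sum_(l < k) (tail l - tail l.+1) / sigma l.+1 ^+ 2.
Proof.
elim: k => [|k IH].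
  rewrite big_ord0 mulr0 /prod_sum big1// => a _.
  by rewrite /mart big_ord0 expr0n mulr0.
rewrite big_ord_recr/= mulrDr.
rewrite (@eq_prod_sum _ _ _ pi _ (fun a => mart k a ^+ 2 +
    (2 * (mart k a * \sum_i increment k (a i)) + (\sum_i increment k (a i)) ^+ 2))).
  rewrite !prod_sumD prod_sumZ increment_orthogonal; last by move=> *; exact: mart_update.
  rewrite mulr0 add0r lerD// prod_sum_sqr_sum ?increment_centered//.
  by rewrite ler_wpM2l ?ler0n// increment_sqr.
by move=> a; rewrite /mart big_ord_recr/=; ring.
Qed.

Lemma running_max_mart_update (s : R) k a i (c c' : 'I_K.+1) :
  (k <= c)%N -> (k <= c')%N ->
  running_max (fun l => s * mart l (update a i c)) k =
  running_max (fun l => s * mart l (update a i c')) k.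
Proof.
elim: k => [|k IH] kc kc' /=; first by rewrite (mart_update a i kc kc').
by rewrite IH ?(mart_update a i kc kc')// ltnW.
Qed.

(** The sign [s] covers the maximum of the martingale and of its opposite at once. In the pathwise
    inequality the stochastic integral has mean zero because the running maximum is adapted. *)
Lemma doob_mart (s : R) k : s ^+ 2 = 1 ->
  prod_sum pi (fun a => running_max (fun l => s * mart l a) k ^+ 2) <=
  4 * prod_sum pi (fun a => mart k a ^+ 2).
Proof.
move=> s2; pose S l a := running_max (fun l => s * mart l a) l.
apply: (@le_trans _ _ (prod_sum pi (fun a => 4 * mart k a ^+ 2 +
    (- 4) * \sum_(l < k) S l a * (s * \sum_i increment l (a i))))).
  apply: le_prod_sum => // a; rewrite /S.
  have := @doob_pathwise _ (fun l => s * mart l a) k.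
  rewrite /mart big_ord0 mulr0 => /(_ erefl) /le_trans; apply.
  rewrite exprMn s2 mul1r lerD2l mulNr lerN2 ler_wpM2l// ler_sum// => l _.
  by rewrite big_ord_recr/= le_eqVlt; apply/orP; left; apply/eqP; ring.
rewrite prod_sumD !prod_sumZ prod_sum_sum big1 ?mulr0 ?addr0// => l _.
rewrite (@eq_prod_sum _ _ _ pi _
  (fun a => s * (S l a * \sum_i increment l (a i)))); last first.
  by move=> a; ring.
rewrite prod_sumZ increment_orthogonal ?mulr0// => *.
exact: running_max_mart_update.
Qed.

Definition dev_bound a : R := max_sqr (fun l => mart l a) K.

(** The normalized deviation solves y(k+1) = a(k) y(k) + (increment of [mart]) with a(k) =
    [ratio k * (sigma k / sigma k.+1)], which lies in [0, 1] since [sigma] is nondecreasing. *)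
Lemma tail_dev_le k a : (k <= K)%N ->
  (tail_dev k a / sigma k) ^+ 2 <= dev_bound a.
Proof.
have s0 l : sigma l != 0 by rewrite gt_eqF.
apply: (@contraction_le_max_sqr _ (fun l => mart l a)
  (fun k => tail_dev k a / sigma k) (fun k => ratio k * (sigma k / sigma k.+1))).
- by rewrite /mart big_ord0.
- by rewrite /tail_dev big1 ?mul0r// => i _; rewrite tail0 subrr.
- move=> j; have /andP[r0 r1] := ratio01 j.
  have q0 : 0 <= sigma j / sigma j.+1 by rewrite divr_ge0// ltW.
  have q1 : sigma j / sigma j.+1 <= 1 by rewrite ler_pdivrMr// mul1r.
  by rewrite mulr_ge0//= mulr_ile1.
- move=> j; rewrite /mart big_ord_recr/= [X in _ + (X - _)]addrC addrK.
  rewrite (_ : _ * _ * _ = ratio j * tail_dev j a / sigma j.+1); last first.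
    by field; rewrite !s0.
  rewrite /tail_dev /increment -mulr_suml -mulrDl; congr (_ / _).
  rewrite mulr_sumr -big_split/=; apply: eq_bigr => i _.
  by rewrite mulrBr ratioK; ring.
Qed.

(** The constant 64 is 8 from [max_sqr], times 4 from Doob, times 2 for the two signs. *)
Lemma prod_sum_dev_bound : prod_sum pi dev_bound <=
  64 * (n%:R * \sum_(l < K) (tail l - tail l.+1) / sigma l.+1 ^+ 2).
Proof.
rewrite /dev_bound /max_sqr prod_sumZ prod_sumD.
have H1 := @doob_mart 1 K; rewrite expr1n in H1; have {}H1 := H1 erefl.
have H2 := @doob_mart (-1) K; rewrite sqrrN expr1n in H2; have {}H2 := H2 erefl.
have -> : prod_sum pi (fun a => running_max (fun l => mart l a) K ^+ 2) =
   prod_sum pi (fun a => running_max (fun l => 1 * mart l a) K ^+ 2).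
  apply: eq_prod_sum => a; congr (running_max _ _ ^+ 2).
  by apply/funext => l; rewrite mul1r.
have -> : prod_sum pi (fun a => running_max (\- (fun l => mart l a)) K ^+ 2) =
   prod_sum pi (fun a => running_max (fun l => -1 * mart l a) K ^+ 2).
  apply: eq_prod_sum => a; congr (running_max _ _ ^+ 2).
  by apply/funext => l; rewrite mulN1r.
have := mart_sqr K; lra.
Qed.

End cell_martingale.

(** * Transfer to i.i.d. samples *)

Section fibers.
Context d (T : measurableType d) (R : realType) (mu : probability T R).
Context (I : finType) (h : T -> I).
Hypothesis mh : forall i, measurable (h @^-1` [set i]).

Lemma fun_fibersE (phi : I -> R) y :
  phi (h y) = \sum_i phi i * \1_(h @^-1` [set i]) y.
Proof.
rewrite (bigD1 (h y))//= big1 => [|i ih].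
  by rewrite addr0 indicE mem_set// mulr1.
by rewrite indicE memNset ?mulr0//= => e; rewrite e eqxx in ih.
Qed.

Lemma measurable_fun_fibers (phi : I -> R) : measurable_fun setT (phi \o h).
Proof.
rewrite (_ : _ \o _ = fun y => \sum_i phi i * \1_(h @^-1` [set i]) y); last first.
  by apply/funext => y; rewrite -fun_fibersE.
by apply: measurable_sum => i; exact: measurable_funM.
Qed.

Lemma integral_fibers (phi : I -> R) : (forall i, 0 <= phi i) ->
  (\int[mu]_y (phi (h y))%:E =
   (\sum_i phi i * fine (mu (h @^-1` [set i])))%:E)%E.
Proof.
move=> phi0.
under eq_integral do rewrite fun_fibersE -sumEFin.
rewrite ge0_integral_sum//=; last 2 first.
- by move=> i; apply/measurable_EFinP; exact: measurable_funM.
- by move=> i y _; rewrite lee_fin mulr_ge0.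
rewrite -sumEFin; apply: eq_bigr => i _.
under eq_integral do rewrite EFinM.
rewrite ge0_integralZl ?lee_fin//; last first.
  by apply/measurable_EFinP; exact: measurable_indic.
by rewrite integral_indic// setIT EFinM fineK// fin_num_measure.
Qed.

End fibers.

Section iid_maximal.
Context d (T : measurableType d) (R : realType) (F : probability T R).
Context (n K : nat) (D : nat -> set T) (sigma : nat -> R).
Hypothesis D0 : D 0%N = setT.
Hypothesis mD : forall k, measurable (D k).
Hypothesis Dni : forall k, D k.+1 `<=` D k.
Hypothesis sigma_gt0 : forall k, 0 < sigma k.
Hypothesis sigma_nd : forall k, sigma k <= sigma k.+1.

(** Index of the last of the nested sets D 0, ..., D K containing [y]. The default [ord0] is always
    admissible because D 0 is the whole space. *)
Definition cell (y : T) : 'I_K.+1 :=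
  [arg max_(k > ord0 | `[< D k y >]) (k : nat)]%N.

Lemma D_nonincreasing j k : (j <= k)%N -> D k `<=` D j.
Proof.
elim: k => [|k IH]; first by rewrite leqn0 => /eqP ->.
rewrite leq_eqVlt => /orP[/eqP -> //|jk].
by apply: (subset_trans (@Dni k)); exact: IH.
Qed.

Lemma cellP k y : (k <= K)%N -> (k <= cell y)%N <-> D k y.
Proof.
move=> kK; rewrite /cell; case: arg_maxnP; first by apply/asboolP; rewrite D0.
move=> c /asboolP Dc cmax; split=> [kc|Dk]; first exact: D_nonincreasing Dc.
by apply: (cmax (Ordinal (kK : (k < K.+1)%N))); apply/asboolP.
Qed.

Lemma measurable_cell_ge k : measurable [set y | (k <= cell y)%N].
Proof.
have [kK|Kk] := leqP k K.
  by rewrite (_ : [set _ | _] = D k)//; apply/seteqP; split=> y /= /(cellP _ kK).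
rewrite (_ : [set _ | _] = set0)//; apply/seteqP; split=> y //=.
by move=> kc; have := leq_trans Kk kc; rewrite ltnNge -ltnS ltn_ord.
Qed.

Lemma measurable_cell c : measurable (cell @^-1` [set c]).
Proof.
rewrite (_ : _ @^-1` _ = [set y | (c <= cell y)%N] `\` [set y | (c < cell y)%N]).
  by apply: measurableD; exact: measurable_cell_ge.
apply/seteqP; split=> y /=; first by move=> ->; split=> //; rewrite ltnn.
by move=> [cy /negP]; rewrite -leqNgt => yc; apply/val_inj/anti_leq; rewrite /= yc.
Qed.

Let pi c := fine (F (cell @^-1` [set c])).

Lemma cell_tail k : (k <= K)%N -> tail pi k = fine (F (D k)).
Proof.
move=> kK; rewrite /tail /pi; under eq_bigr do rewrite mulrC.
apply: EFin_inj.
rewrite -(integral_fibers F measurable_cell (phi := fun c => (k <= c)%:R))//.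
rewrite -[in RHS](setIT (D k)) -integral_indic// fineK; last first.
  by rewrite integral_indic// fin_num_measure//; apply: measurableI.
apply: eq_integral => y _; rewrite indicE; congr ((nat_of_bool _)%:R)%:E.
by apply/idP/idP; rewrite inE => /(cellP _ kK).
Qed.

Let cells (y : n.-tuple T) : {ffun 'I_n -> 'I_K.+1} :=
  [ffun i => cell (tnth y i)].

Let cells_preimage a : cells @^-1` [set a] =
  [set y | forall i, (cell @^-1` [set a i]) (tnth y i)].
Proof.
apply/seteqP; split=> y /=; first by move=> <- i; rewrite ffunE.
by move=> H; apply/ffunP => i; rewrite ffunE.
Qed.

Let measurable_cells a : measurable (cells @^-1` [set a]).
Proof.
rewrite cells_preimage.
rewrite (_ : [set _ | _] = \bigcap_(i in [set: 'I_n])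
    ((@tnth _ T ^~ i) @^-1` (cell @^-1` [set a i]))); last first.
  by apply/seteqP; split=> x /= H i; [move=> _; exact: H|exact: H].
apply: fin_bigcap_measurable => // i _.
rewrite -[X in measurable X]setTI.
by apply: measurable_tnth => //; exact: measurable_cell.
Qed.

(** The law of the vector of cells is the finite product law, so the bound on [dev_bound] transfers.
    A single majorant [W] serving every [k] replaces the supremum and is measurable as a function of
    finitely many cells. *)
Lemma iid_maximal_inequality : exists W : n.-tuple T -> R,
  [/\ measurable_fun setT W, forall y, 0 <= W y,
      forall k y, (k <= K)%N ->
        ((\sum_(i < n) (fine (F (D k)) - \1_(D k) (tnth y i))) / sigma k) ^+ 2
        <= W y
    & (\int[iid_law F n]_y (W y)%:E <=
       (64 * (n%:R * \sum_(l < K) (fine (F (D l)) - fine (F (D l.+1)))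
                                   / sigma l.+1 ^+ 2))%:E)%E].
Proof.
have pi_sum : \sum_j pi j = 1.
  have := cell_tail (leq0n K); rewrite D0 probability_setT /= /tail => <-.
  by apply: eq_bigr => c _; rewrite mulr1.
have pi_ge0 j : 0 <= pi j by exact: fine_ge0.
exists (dev_bound pi sigma \o cells); split.
- exact: measurable_fun_fibers.
- by move=> y; exact: max_sqr_ge0.
- move=> k y kK; have := tail_dev_le pi_sum pi_ge0 sigma_gt0 sigma_nd (cells y) kK.
  move/(le_trans _); apply; rewrite le_eqVlt; apply/orP; left; apply/eqP.
  congr ((_ / _) ^+ 2); apply: eq_bigr => i _; rewrite cell_tail// ffunE indicE.
  congr (_ - (nat_of_bool _)%:R); apply/idP/idP; first by rewrite inE => /(cellP _ kK).
  by move/(cellP _ kK) => ?; rewrite inE.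
- rewrite (integral_fibers (iid_law F n) measurable_cells); last first.
    by move=> a; exact: max_sqr_ge0.
  rewrite lee_fin.
  have := @prod_sum_dev_bound _ n _ pi sigma pi_sum pi_ge0 sigma_gt0.
  rewrite (eq_bigr (fun l : 'I__ => (fine (F (D l)) - fine (F (D l.+1)))
                                   / sigma l.+1 ^+ 2)); last first.
    by move=> l _; rewrite !cell_tail// ltnW.
  move/(le_trans _); apply; rewrite le_eqVlt; apply/orP; left; apply/eqP.
  apply: eq_bigr => a _; rewrite mulrC; congr (_ * _).
  (* The fiber over [a] is a box, whose probability is the product weight of [a]. *)
  rewrite cells_preimage (iid_law_box F (A := fun i => cell @^-1` [set a i])); last first.
    by move=> i; exact: measurable_cell.
  rewrite (eq_bigr (fun i => (pi (a i))%:E)) ?prodEFin// => i _.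
  by rewrite fineK// fin_num_measure//; exact: measurable_cell.
Qed.

End iid_maximal.

(** * Functions whose right Dini derivative is nonpositive almost everywhere *)

Section dini.
Context {R : realType}.
Implicit Types (G : R -> R) (a b x : R).

(** The upper right Dini derivative of [G] at [x], within points up to [b], is at most 0. *)
Definition dini_le0 G b x := forall e, 0 < e ->
  exists2 d, 0 < d & forall y, x < y < x + d -> y <= b -> G y - G x <= e * (y - x).

(** A supremum argument: for each slope e > 0, the points where [G] has grown by at most e (x - a)
    reach up to [b], since the Dini condition would extend them past any smaller supremum. *)
Lemma dini_le0_le G a b K : a <= b ->
  (forall x y, a <= x -> x <= y -> y <= b -> G y - G x <= K * (y - x)) ->
  (forall x, a <= x < b -> dini_le0 G b x) -> G b <= G a.
Proof.
move=> ab GK Gd.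
have [ba|ab'] := leP b a.
  by rewrite (_ : b = a)//; apply/eqP; rewrite eq_le ba ab.
rewrite -subr_le0; apply/ler_addgt0Pr => e0 e0_gt0; rewrite add0r.
pose e := e0 / (b - a).
have e_gt0 : 0 < e by rewrite divr_gt0// subr_gt0.
have -> : e0 = e * (b - a) by rewrite /e divfK// subr_eq0 gt_eqF.
pose A := [set x | a <= x <= b /\ G x - G a <= e * (x - a)].
have Aa : A a by split; [rewrite lexx ab|rewrite !subrr mulr0].
have ubA : ubound A b by move=> x [/andP[_ ?] _].
have supA : has_sup A by split; [exists a|exists b].
set s := sup A.
have sb : s <= b by apply: ge_sup => //; exists a.
have sa : a <= s by exact: (ub_le_sup (ex_intro _ b ubA) Aa).
(* The one-sided growth bound excludes an upward jump at [s], so the supremum belongs to [A]. *)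
have As : G s - G a <= e * (s - a).
  apply/ler_addgt0Pr => h h0.
  have K1 : 0 < `|K| + 1 by rewrite ltr_wpDl.
  have h'0 : 0 < h / (`|K| + 1) by rewrite divr_gt0.
  have [x [/andP[ax xb] Ax] xs] := sup_adherent h'0 supA.
  have xs' : x <= s by apply: ub_le_sup; [exists b|split=> //; rewrite ax].
  have := GK x s ax xs' sb.
  have : K * (s - x) <= h.
    apply: (@le_trans _ _ ((`|K| + 1) * (s - x))).
      by rewrite ler_wpM2r ?subr_ge0// (le_trans (ler_norm _))// lerDl.
    rewrite mulrC -ler_pdivlMr//; have : s - h / (`|K| + 1) < x by []; lra.
  have : 0 <= e * (s - x) by rewrite mulr_ge0 ?subr_ge0// ltW.
  lra.
have [->//|sb'] := eqVneq b s.
have {}sb : s < b by rewrite lt_def sb' sb.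
have [d d0 Hd] := Gd s (introT andP (conj sa sb)) e e_gt0.
pose y := Num.min (s + d / 2) b.
have sy : s < y by rewrite /y lt_min sb andbT ltrDl divr_gt0.
have yb : y <= b by rewrite /y ge_min lexx orbT.
have yd : y < s + d by rewrite /y gt_min ltrD2l ltr_pdivrMr// ltr_pMr// ltr1n.
have := Hd y (introT andP (conj sy yd)) yb => Gy.
have : y <= s; last by rewrite leNgt sy.
apply: ub_le_sup; first by exists b.
split; first by rewrite yb (le_trans sa (ltW sy)).
lra.
Qed.

Local Notation mu := (@lebesgue_measure R).

(* Subtracting K times the measure of U below x makes G decrease on U too, where
   U is an open set of small measure containing the exceptional points. *)
Lemma ae_dini_le0_le G a b K : a <= b -> 0 <= K ->
  (forall x y, a <= x -> x <= y -> y <= b -> G y - G x <= K * (y - x)) ->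
  {ae mu, forall x, x \in `[a, b] -> dini_le0 G b x} -> G b <= G a.
Proof.
move=> ab K0 GK [N [mN N0 NG]].
apply/ler_addgt0Pr => h h0.
have K1 : 0 < K + 1 by rewrite ltr_wpDl.
have h'0 : 0 < h / (K + 1) by rewrite divr_gt0.
have {}N0 : mu N = 0%E by exact: N0.
have muN : (mu N < +oo)%E by rewrite N0 ltry.
have [U [oU NU muU]] := lebesgue_regularity_outer mN muN h'0.
have mU : measurable U by exact: open_measurable.
pose phi x : R := fine (mu (U `&` `]a, x])).
have finU x y : mu (U `&` `]x, y]) \is a fin_num.
  rewrite ge0_fin_numE// (le_lt_trans (le_measure mu _ _ (@subIsetr _ U `]x, y])))//.
  - by rewrite inE; apply: measurableI.
  - by rewrite inE.
  - by rewrite /= lebesgue_measure_itv/=; case: ifP; rewrite -?EFinB ltry.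
have phiD x y : a <= x -> x <= y -> phi y = phi x + fine (mu (U `&` `]x, y])).
  move=> ax xy; rewrite /phi -fineD//; congr fine.
  rewrite -measureU//; [|by apply: measurableI..|].
    congr (mu _); rewrite -setIUr; congr (_ `&` _).
    by rewrite -itv_bndbnd_setU// bnd_simp.
  apply/seteqP; split=> z //= -[[_]]; rewrite !in_itv/= => /andP[_ zx] [_ /andP[xz _]].
  by move: (lt_le_trans xz zx); rewrite ltxx.
have phi_a : phi a = 0 by rewrite /phi set_itvoc0 setI0 measure0.
have phi_nd x y : a <= x -> x <= y -> phi x <= phi y.
  by move=> ax xy; rewrite (phiD x y)// lerDl fine_ge0.
have phi_b : phi b <= h / (K + 1).
  rewrite -lee_fin fineK// (@le_trans _ _ (mu U))//.
    by apply: le_measure; rewrite ?inE//; apply: measurableI.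
  rewrite -(setDUK NU) measureU//; [|exact: measurableD|exact: setDIK].
  rewrite -[X in (X <= _)%E]/(mu N + mu (U `\` N))%E N0 add0e ltW//.
have : G b - K * phi b <= G a - K * phi a.
  apply: (@dini_le0_le (fun x => G x - K * phi x) a b K) =>
      // [x y ax xy yb|x /andP[ax xb]].
    have := GK x y ax xy yb.
    have : 0 <= K * (phi y - phi x) by rewrite mulr_ge0// subr_ge0 phi_nd.
    lra.
  (* Inside U, [phi] has slope 1 to the right of [x], so K * [phi] cancels the allowed growth of
     [G]. Outside U, the Dini condition holds at [x] and the monotone [phi] can only help. *)
  move=> e e0; have [xU|xU] := pselect (U x).
    have /nbhs_ballP[d /= d0 dU] : nbhs x U by exact: open_nbhs_nbhs.
    exists d => // y /andP[xy yd] yb.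
    rewrite (phiD x y)//; last exact: ltW.
    rewrite (_ : U `&` _ = `]x, y]%classic); last first.
      apply: setIidr => z /=; rewrite in_itv/= => /andP[xz zy]; apply: dU.
      by rewrite /ball /= distrC gtr0_norm ?subr_gt0// ltrBlDl (le_lt_trans zy).
    rewrite lebesgue_measure_itv/= lte_fin xy -EFinB/=.
    have := GK x y ax (ltW xy) yb.
    have : 0 < e * (y - x) by rewrite mulr_gt0// subr_gt0.
    lra.
  have dG : dini_le0 G b x.
    apply: contrapT => nG; apply: xU; apply: NU; apply: NG => /= H.
    by apply: nG; apply: H; rewrite in_itv/= ax ltW.
  have [d d0 Hd] := dG e e0; exists d => // y xyd yb.
  have := Hd y xyd yb; have /andP[xy _] := xyd.
  have : 0 <= K * (phi y - phi x) by rewrite mulr_ge0// subr_ge0 phi_nd// ltW.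
  lra.
rewrite phi_a mulr0 subr0.
have : K * phi b <= h.
  rewrite (@le_trans _ _ (K * (h / (K + 1))))// ?ler_wpM2l//.
  by rewrite mulrCA ler_piMr ?(ltW h0)// ler_pdivrMr// mul1r lerDl.
lra.
Qed.

End dini.

(** * Taylor estimates for the revenue *)

Section density.
Context {R : realType} (F : probability (measurableTypeR R) R) (f : R -> R).
Context (C0 Cstar Cbar pU : R).
Hypothesis C0_gt0 : 0 < C0.
Hypothesis Cstar_gt0 : 0 < Cstar.
Hypothesis Ff : has_density01 F f.
Hypothesis regF : regular C0 Cstar Cbar F f pU.
Hypothesis pU_max : maximizes01 (revenue F) pU.

Local Notation mu := (@lebesgue_measure R).
Local Notation M := (1 + C0).

Let f_lip := regular_lipschitz regF.

Let f_ge0 y : y \in `[0, 1] -> 0 <= f y.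
Proof. by case: Ff => _ + _; apply. Qed.

Let mf (A : set (measurableTypeR R)) : measurable A ->
  measurable_fun (A `&` `[0, 1]) (EFin \o f).
Proof.
move=> mA; apply/measurable_EFinP.
by case: Ff => mf _ _; apply: measurable_funS mf => //; exact: subIsetr.
Qed.

Lemma prob_le (A : set (measurableTypeR R)) c : measurable A -> 0 <= c ->
  (forall y, A y -> y \in `[0, 1] -> f y <= c) ->
  (F A <= c%:E * mu (A `&` `[0%R, 1%R]))%E.
Proof.
move=> mA c0 fc; case: (Ff) => _ _ ->//.
have mA1 : measurable (A `&` `[0%R, 1%R]) by apply: measurableI.
rewrite -(integral_cst mu mA1); apply: ge0_le_integral => //.
- by move=> y [_ y01]; rewrite lee_fin f_ge0.
- exact: mf.
- by move=> y [Ay y01]; rewrite lee_fin fc.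
Qed.

Lemma prob_ge (A : set (measurableTypeR R)) c : measurable A -> 0 <= c ->
  (forall y, A y -> y \in `[0, 1] -> c <= f y) ->
  (c%:E * mu (A `&` `[0%R, 1%R]) <= F A)%E.
Proof.
move=> mA c0 fc; case: (Ff) => _ _ ->//.
have mA1 : measurable (A `&` `[0%R, 1%R]) by apply: measurableI.
rewrite -(integral_cst mu mA1); apply: ge0_le_integral => //.
- exact: mf.
- by move=> y [Ay y01]; rewrite lee_fin fc.
Qed.

Lemma lebesgue_measure_itvcc01 : mu `[0%R, 1%R] = 1%E.
Proof. by rewrite lebesgue_measure_itv/= lte_fin ltr01 oppr0 adde0. Qed.

(** By the Lipschitz condition [f] is at least f y - C0 on all of [0, 1], and its integral there is
    1. *)
Lemma density_le y : y \in `[0, 1] -> f y <= M.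
Proof.
move=> y01; have [c0|c0] := leP (f y - C0) 0; first by lra.
have := @prob_ge setT (f y - C0) measurableT (ltW c0).
rewrite setTI lebesgue_measure_itvcc01 probability_setT mule1 lee_fin.
suff fy z : z \in `[0, 1] -> f y - C0 <= f z.
  by move=> /(_ (fun z _ => fy z)); lra.
move=> z01; have := f_lip y01 z01.
have : C0 * `|y - z| <= C0 * 1.
  rewrite ler_wpM2l ?(ltW C0_gt0)//; move: y01 z01; rewrite !in_itv/= ler_norml; lra.
by have := ler_norm (f y - f z); lra.
Qed.

Lemma prob_itv_le (b0 b1 : bool) a b : a <= b ->
  fine (F [set` Interval (BSide b0 a) (BSide b1 b)]) <= M * (b - a).
Proof.
move=> ab; have M0 : 0 <= M by rewrite addr_ge0// ltW.
rewrite -lee_fin fineK ?fin_num_measure//.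
apply: (le_trans (@prob_le _ M _ M0 _)) => //.
  by move=> y _; exact: density_le.
rewrite EFinM; apply: lee_wpmul2l; first by rewrite lee_fin.
apply: (@le_trans _ _ (mu [set` Interval (BSide b0 a) (BSide b1 b)])).
  by apply: le_measure; rewrite ?inE//; apply: measurableI.
rewrite lebesgue_measure_itv/=; case: ifP => _; first by rewrite EFinB.
by rewrite lee_fin subr_ge0.
Qed.

Lemma prob_set1 x : F [set x] = 0%E.
Proof.
rewrite -set_itv1; apply/eqP; rewrite -[F _]fineK ?fin_num_measure//.
rewrite eqe eq_le fine_ge0// andbT.
by rewrite (le_trans (prob_itv_le _ _ (lexx x)))// subrr mulr0.
Qed.

Lemma prob_ae_01 : F (~` `[0, 1]%classic) = 0%E.
Proof.
case: (Ff) => _ _ ->; last exact: measurableC.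
by rewrite setICl integral_set0.
Qed.

Lemma cdf_ge0 x : 0 <= cdf_of F x.
Proof. exact: fine_ge0. Qed.

Lemma cdf_le1 x : cdf_of F x <= 1.
Proof. by rewrite /cdf_of -lee_fin fineK ?fin_num_measure// probability_le1. Qed.

Lemma cdfB a b : a <= b -> cdf_of F b - cdf_of F a = fine (F `]a, b]%classic).
Proof.
move=> ab; rewrite /cdf_of.
have -> : `]-oo, b]%classic = `]-oo, a]%classic `|` `]a, b]%classic.
  by rewrite -itv_bndbnd_setU// bnd_simp.
rewrite measureU//.
  by rewrite fineD ?fin_num_measure// addrAC subrr add0r.
apply/seteqP; split=> z //= -[]; rewrite !in_itv/= => za /andP[az _].
by move: (lt_le_trans az za); rewrite ltxx.
Qed.

Lemma cdf_taylor a b : 0 <= a -> a <= b -> b <= 1 ->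
  `|cdf_of F b - cdf_of F a - f a * (b - a)| <= C0 * (b - a) ^+ 2.
Proof.
move=> a0 ab b1; rewrite cdfB//.
have a01 : a \in `[0, 1] by rewrite in_itv/= a0 (le_trans ab).
have muab : mu (`]a, b] `&` `[0%R, 1%R]) = (b - a)%:E.
  rewrite setIidl => [|y /=]; last by rewrite !in_itv/= => /andP[ay yb]; lra.
  rewrite lebesgue_measure_itv/= lte_fin; case: ltP => ba; first by rewrite EFinB.
  by rewrite (_ : b = a) ?subrr//; apply/eqP; rewrite eq_le ba ab.
have fdist y : `]a, b]%classic y -> y \in `[0, 1] -> `|f a - f y| <= C0 * (b - a).
  move=> yab y01; apply: (le_trans (f_lip a01 y01)).
  rewrite ler_wpM2l ?(ltW C0_gt0)// ler_norml.
  by move: yab; rewrite /= in_itv/= => /andP[? ?]; lra.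
have d0 : 0 <= C0 * (b - a) by rewrite mulr_ge0 ?subr_ge0// ltW.
have f0 := f_ge0 a01.
have up : fine (F `]a, b]%classic) <= (f a + C0 * (b - a)) * (b - a).
  rewrite -lee_fin fineK ?fin_num_measure// EFinM -muab.
  apply: prob_le => // [|y yab y01]; first by rewrite addr_ge0.
  by have := fdist y yab y01; rewrite ler_norml; lra.
have lo : (f a - C0 * (b - a)) * (b - a) <= fine (F `]a, b]%classic).
  (* [prob_ge] takes nonnegative constants only; for a negative one the bound is trivial. *)
  have [c0|c0] := leP 0 (f a - C0 * (b - a)); last first.
    apply: (@le_trans _ _ 0); last exact: fine_ge0.
    by rewrite mulr_le0_ge0 ?subr_ge0// ltW.
  rewrite -lee_fin fineK ?fin_num_measure// EFinM -muab.
  apply: prob_ge => // y yab y01.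
  by have := fdist y yab y01; rewrite ler_norml; lra.
rewrite ler_norml; move: up lo; rewrite mulrDl mulrBl expr2 mulrA; lra.
Qed.

(** Without atoms, 1 - F(p) is the mass of the closed half-line, which is what the empirical revenue
    estimates. *)
Lemma revenueE p : revenue F p = p * fine (F `[p, +oo[%classic).
Proof.
rewrite /revenue; congr (_ * _); rewrite /cdf_of.
have -> : `[p, +oo[%classic = ~` `]-oo, p]%classic `|` [set p].
  rewrite setCitvl -set_itv1 setUC -itv_bndbnd_setU// bnd_simp//.
rewrite measureU0//; [|exact: measurableC|exact: prob_set1].
have mp : measurable (`]-oo, p]%classic : set (measurableTypeR R)) by [].
transitivity (fine (1 - F `]-oo, p]%classic)%E).
  by rewrite fineB// fin_num_measure.
by rewrite -(probability_setC F mp).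
Qed.

Lemma revenue_ge0 p : 0 <= p -> 0 <= revenue F p.
Proof. by move=> p0; rewrite mulr_ge0// subr_ge0 cdf_le1. Qed.

Definition revenue' (x : R) := 1 - cdf_of F x - x * f x.

Lemma revenue'_lip a b : 0 <= a -> a <= b -> b <= 1 ->
  `|revenue' b - revenue' a| <= (2 * M + C0) * (b - a).
Proof.
move=> a0 ab b1.
have a01 : a \in `[0, 1] by rewrite in_itv/= a0 (le_trans ab).
have b01 : b \in `[0, 1] by rewrite in_itv/= b1 (le_trans a0).
have cM : `|cdf_of F b - cdf_of F a| <= M * (b - a).
  by rewrite cdfB// ger0_norm ?fine_ge0// prob_itv_le.
have fM : `|(b - a) * f b| <= M * (b - a).
  rewrite normrM (ger0_norm (f_ge0 b01)) ger0_norm ?subr_ge0// mulrC.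
  by rewrite ler_wpM2r ?subr_ge0// density_le.
have af : `|a * (f b - f a)| <= C0 * (b - a).
  rewrite normrM -[leRHS]mul1r ler_pM//.
    by rewrite ger0_norm// (le_trans ab).
  by rewrite (le_trans (f_lip b01 a01))// ger0_norm ?subr_ge0.
rewrite (_ : _ - _ = - (cdf_of F b - cdf_of F a) - (b - a) * f b - a * (f b - f a)).
  rewrite (le_trans (ler_normB _ _))// (le_trans (lerD (ler_normB _ _) (lexx _)))//.
  by rewrite normrN; lra.
by rewrite /revenue'; ring.
Qed.

Lemma revenue_taylor_right a b : 0 <= a -> a <= b -> b <= 1 ->
  `|revenue F b - revenue F a - revenue' a * (b - a)| <= (C0 + M) * (b - a) ^+ 2.
Proof.
move=> a0 ab b1; have a01 : a \in `[0, 1] by rewrite in_itv/= a0 (le_trans ab).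
have -> : revenue F b - revenue F a - revenue' a * (b - a) =
    - (b * (cdf_of F b - cdf_of F a - f a * (b - a))) - f a * (b - a) ^+ 2.
  by rewrite /revenue /revenue'; ring.
rewrite (le_trans (ler_normB _ _))// mulrDl lerD//.
  rewrite normrN normrM -[leRHS]mul1r ler_pM ?cdf_taylor// ger0_norm//.
  exact: le_trans ab.
rewrite normrM (ger0_norm (sqr_ge0 _)) ler_wpM2r ?sqr_ge0//.
by rewrite ger0_norm ?f_ge0// density_le.
Qed.

(** For b < a the expansion is taken at [b] and its slope moved to [a]: the constant is (C0 + M) +
    (2 M + C0), the second term coming from [revenue'_lip]. *)
Lemma revenue_taylor a b : a \in `[0, 1] -> b \in `[0, 1] ->
  `|revenue F b - revenue F a - revenue' a * (b - a)| <= (3 * M + 2 * C0) * (b - a) ^+ 2.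
Proof.
rewrite !in_itv/= => /andP[a0 a1] /andP[b0 b1].
have s0 := sqr_ge0 (b - a).
have [ab|/ltW ba] := leP a b.
  apply: (le_trans (revenue_taylor_right a0 ab b1)); 
  by rewrite ler_wpM2r//; move: C0_gt0; lra.
have H := revenue_taylor_right b0 ba a1; have := revenue'_lip b0 ba a1.
have -> : revenue F b - revenue F a - revenue' a * (b - a) =
  - (revenue F a - revenue F b - revenue' b * (a - b)) +
    (revenue' a - revenue' b) * (a - b) by ring.
move=> H'; rewrite (le_trans (ler_normD _ _))// normrN.
rewrite normrM [`|a - b|]ger0_norm ?subr_ge0//.
have := ler_wpM2r (_ : 0 <= a - b) H'; rewrite subr_ge0 => /(_ ba).
move: H; set X := `|revenue F a - _ - _|; set Y := `|revenue' a - _|.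
move=> H1 H2; move: H1 H2; rewrite (_ : (b - a) ^+ 2 = (a - b) ^+ 2); last by ring.
lra.
Qed.

Let pU01 : 0 < pU < 1.
Proof. by have := regular_interior regF; rewrite in_itv. Qed.

(** First-order condition at an interior maximum: a move by g e would gain at least g^2 e (1 - L e),
    which is positive for small e unless g = 0. *)
Lemma revenue'_pU : revenue' pU = 0.
Proof.
have /andP[p0 p1] := pU01; set g := revenue' pU; set L := 3 * M + 2 * C0.
have L0 : 0 < L by rewrite /L; move: C0_gt0; lra.
apply/eqP; apply: contraT => g0.
have g2 : 0 < g ^+ 2 by rewrite exprn_even_gt0.
have gn : 0 < `|g| by rewrite normr_gt0.
pose m := Num.min pU (1 - pU).
have m0 : 0 < m by rewrite /m lt_min p0 subr_gt0.
(* The first bound gives L e <= 1/2; the second keeps pU + g e inside [0, 1]. *)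
pose e := Num.min (L^-1 / 2) (m / `|g|).
have e0 : 0 < e by rewrite /e lt_min !divr_gt0// invr_gt0.
have eL : L * e <= 2^-1.
  by rewrite -ler_pdivlMl// /e ge_min lexx.
have eg : `|g * e| <= m.
  by rewrite normrM (gtr0_norm e0) -ler_pdivlMl// mulrC /e ge_min lexx orbT.
have [mp mp1] : m <= pU /\ m <= 1 - pU by rewrite /m !ge_min !lexx orbT.
have q01 : pU + g * e \in `[0, 1].
  by move: eg; rewrite in_itv/= ler_norml => /andP[? ?]; lra.
have p01 : pU \in `[0, 1] by rewrite in_itv/= !ltW.
have := revenue_taylor p01 q01; have [_ /(_ _ q01)] := pU_max.
rewrite (addrC pU) addrK -/g -/L ler_norml => H /andP[H' _].
have : g ^+ 2 * e <= L * e * (g ^+ 2 * e) by move: H'; nra.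
have ge : 0 < g ^+ 2 * e by rewrite mulr_gt0.
nra.
Qed.

Lemma revenue_upper p : p \in `[0, 1] ->
  revenue F pU - revenue F p <= (3 * M + 2 * C0) * (p - pU) ^+ 2.
Proof.
have /andP[p0 p1] := pU01 => p01.
have pU01' : pU \in `[0, 1] by rewrite in_itv/= !ltW.
have := revenue_taylor pU01' p01; rewrite revenue'_pU mul0r ler_norml; lra.
Qed.

Lemma derivable_right (h : R -> R) x e : derivable h x 1 -> 0 < e ->
  exists2 d, 0 < d & forall y, x < y < x + d ->
    `|h y - h x - derive1 h x * (y - x)| <= e * (y - x).
Proof.
move=> dh e0; rewrite derive1E.
have : (fun t => t^-1 *: (h (t *: 1 + x) - h x)) @ 0^' --> 'D_1 h x by exact: dh.
move/cvgrPdist_le => /(_ e e0) /nbhs_ballP[d /= d0 Hd].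
exists d => // y /andP[xy yd].
have yx : 0 < y - x by rewrite subr_gt0.
have := Hd (y - x); rewrite /ball/= sub0r normrN gtr0_norm//.
move=> /(_ _ _); rewrite gt_eqF// ltrBlDl => /(_ yd isT).
rewrite /GRing.scale/= mulr1 subrK => H.
rewrite -(ler_pM2r (x := (y - x)^-1)) ?invr_gt0// mulfK ?gt_eqF//.
rewrite -[X in _ * X]gtr0_norm ?invr_gt0// -normrM mulrBl mulfK ?gt_eqF//.
by rewrite distrC mulrC.
Qed.

(** Integrated form of the second-derivative bound: [revenue'] plus Cstar x has a nonpositive right
    Dini derivative almost everywhere, and it is Lipschitz. *)
Lemma revenue'_decr a b : 0 <= a -> a <= b -> b <= 1 ->
  revenue' b - revenue' a <= - Cstar * (b - a).
Proof.
move=> a0 ab b1.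
suff : revenue' b + Cstar * b <= revenue' a + Cstar * a by lra.
apply: (@ae_dini_le0_le _ (fun x => revenue' x + Cstar * x) a b
  (2 * M + C0 + Cstar)) => //.
- by move: C0_gt0 Cstar_gt0; lra.
- move=> x y ax xy yb; have := revenue'_lip (le_trans a0 ax) xy (le_trans yb b1).
  by rewrite ler_norml; lra.
have [N [mN N0 NS]] := regular_derivative2_le regF.
exists N; split => //; apply: subset_trans NS; apply: subsetC => x Hx xab e e0.
have [ax xb] : a <= x /\ x <= b by move: xab; rewrite in_itv/= => /andP.
have x01 : x \in `[0, 1] by rewrite in_itv/= (le_trans a0 ax) (le_trans xb).
have [df df2] := Hx x01.
have e2 : 0 < e / 2 by rewrite divr_gt0.
have [d d0 Hd] := derivable_right df e2.
(* The first-order expansions of the CDF and of [f] each lose C0 (y - x)^2, at most e / 4 (y - x);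
   the differentiability error takes the other e / 2. *)
exists (Num.min d (e / (4 * C0))); first by rewrite lt_min d0 divr_gt0// mulr_gt0.
move=> y /andP[xy]; rewrite -ltrBlDl lt_min => /andP[yd ye] yb.
have yx : 0 < y - x by rewrite subr_gt0.
have ye' : C0 * (y - x) <= e / 4.
  have := ltW ye; rewrite ler_pdivlMr ?mulr_gt0//; lra.
have x0 : 0 <= x by exact: le_trans ax.
have y1 : y <= 1 by exact: le_trans b1.
have y01 : y \in `[0, 1] by rewrite in_itv/= y1 (le_trans x0)// ltW.
have := Hd y; rewrite xy -ltrBlDl yd => /(_ isT).
have := cdf_taylor x0 (ltW xy) y1; have := f_lip x01 y01.
rewrite [`|x - y|]distrC [`|y - x|]gtr0_norm//.
rewrite !ler_norml => /andP[_ H1] /andP[H2 _] /andP[H3 _].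
have x1 : x <= 1 by exact: le_trans b1.
have K1 := ler_wpM2l (ltW yx) H1.
have K2 := ler_wpM2l (ltW yx) ye'.
have K3 := ler_wpM2l x0 H3.
have K4 := ler_wpM2l (ltW yx) df2.
have K5 : x * (e / 2 * (y - x)) <= e / 2 * (y - x) by rewrite ler_piMl// mulr_ge0// ltW.
rewrite /revenue'; move: K1 K2 K3 K4 K5 H2.
set fx := f x; set fy := f y; set Fx := cdf_of F x; set Fy := cdf_of F y.
set f' := derive1 f x; lra.
Qed.

(** To the right of [pU], [revenue'] is at most - Cstar (x - pU), so adding Cstar / 2 (x - pU)^2 to
    the revenue still gives a nonincreasing function. *)
Lemma revenue_lower p : p \in `[0, 1] ->
  Cstar / 2 * (p - pU) ^+ 2 <= revenue F pU - revenue F p.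
Proof.
have /andP[p0 p1] := pU01; set L := 3 * M + 2 * C0.
have L0 : 0 < L by rewrite /L; move: C0_gt0; lra.
rewrite in_itv/= => /andP[q0 q1].
have small (c : R) x e : 0 < e -> 0 <= c -> exists2 d, 0 < d &
    forall y, x < y < x + d -> c * (y - x) ^+ 2 <= e * (y - x).
  move=> e0 c0; have c1 : 0 < c + 1 by lra.
  exists (e / (c + 1)); first by rewrite divr_gt0.
  move=> y /andP[xy]; rewrite -ltrBlDl ltr_pdivlMr// => yd.
  have yx : 0 < y - x by rewrite subr_gt0.
  by rewrite expr2 mulrA ler_wpM2r// ?ltW//; nra.
have taylor x y : 0 <= x -> x <= y -> y <= 1 ->
    `|revenue F y - revenue F x - revenue' x * (y - x)| <= L * (y - x) ^+ 2.
  by move=> x0 xy y1; apply: revenue_taylor; rewrite in_itv/=; lra.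
have lip x y : 0 <= x -> x <= y -> y <= 1 ->
    - M * (y - x) <= revenue F y - revenue F x <= y - x.
  move=> x0 xy y1; have := prob_itv_le false false xy; rewrite -cdfB// => FM.
  have Fxy : 0 <= cdf_of F y - cdf_of F x by rewrite cdfB// fine_ge0.
  have := cdf_ge0 y; have := cdf_le1 y => F1 F0.
  have -> : revenue F y - revenue F x =
      (y - x) * (1 - cdf_of F y) - x * (cdf_of F y - cdf_of F x).
    by rewrite /revenue; ring.
  have : 0 <= (y - x) * (1 - cdf_of F y) by rewrite mulr_ge0; lra.
  have : (y - x) * (1 - cdf_of F y) <= y - x by rewrite ler_piMr; lra.
  have : 0 <= x * (cdf_of F y - cdf_of F x) by rewrite mulr_ge0.
  have : x * (cdf_of F y - cdf_of F x) <= cdf_of F y - cdf_of F x.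
    by rewrite ler_piMl//; lra.
  lra.
have cL : 0 <= L + Cstar / 2 by move: Cstar_gt0; lra.
have [pq|/ltW qp] := leP pU p.
  pose G x := revenue F x + Cstar / 2 * (x - pU) ^+ 2.
  suff : G p <= G pU by rewrite /G subrr expr0n mulr0 addr0; lra.
  apply: (@dini_le0_le _ G pU p (1 + Cstar) pq) => [x y px xy yp|x /andP[px xp] e e0].
    have /andP[_ Ru] := lip x y ltac:(lra) xy ltac:(lra).
    have : Cstar / 2 * ((y + x - 2 * pU) * (y - x)) <= Cstar / 2 * (2 * (y - x)).
      rewrite ler_wpM2l ?divr_ge0 ?(ltW Cstar_gt0)// ler_wpM2r ?subr_ge0//; lra.
    rewrite /G; lra.
  have [d d0 Hd] := small (L + Cstar / 2) x e e0 cL; exists d => // y xyd yp.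
  have xy : x <= y by case/andP: xyd => /ltW.
  have := taylor x y ltac:(lra) xy ltac:(lra); rewrite ler_norml => /andP[_ T].
  have := Hd y xyd; have := revenue'_decr (ltW p0) px ltac:(lra).
  rewrite revenue'_pU subr0 => D.
  have := ler_wpM2r (_ : 0 <= y - x) D; rewrite subr_ge0 => /(_ xy).
  rewrite /G; lra.
(* On the left the function increases towards [pU]; the sign change makes the monotonicity lemma
   applicable. *)
pose G x := - revenue F x - Cstar / 2 * (x - pU) ^+ 2.
suff : G pU <= G p by rewrite /G subrr expr0n mulr0 subr0; lra.
apply: (@dini_le0_le _ G p pU (M + Cstar) qp) => [x y px xy yp|x /andP[px xp] e e0].
  have /andP[Ru _] := lip x y ltac:(lra) xy ltac:(lra).
  have : Cstar / 2 * ((2 * pU - y - x) * (y - x)) <= Cstar / 2 * (2 * (y - x)).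
    rewrite ler_wpM2l ?divr_ge0 ?(ltW Cstar_gt0)// ler_wpM2r ?subr_ge0//; lra.
  rewrite /G; lra.
have [d d0 Hd] := small (L + Cstar / 2) x e e0 cL; exists d => // y xyd yp.
have xy : x <= y by case/andP: xyd => /ltW.
have := taylor x y ltac:(lra) xy ltac:(lra); rewrite ler_norml => /andP[T _].
have := Hd y xyd; have := revenue'_decr (le_trans q0 px) (ltW xp) (ltW p1).
rewrite revenue'_pU sub0r => D.
have := ler_wpM2r (_ : 0 <= y - x) D; rewrite subr_ge0 => /(_ xy).
have : 0 <= Cstar * (y - x) ^+ 2 by rewrite mulr_ge0 ?sqr_ge0// ltW.
rewrite /G; lra.
Qed.

End density.

(** * Deviations of the empirical measure *)

Section empirical_deviation.
Context d (T : measurableType d) (R : realType) (F : probability T R).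
Context (n : nat).
Hypothesis n_gt0 : (0 < n)%N.
Implicit Types (y : n.-tuple T) (A B : set T).

Definition emp_dev y A : R :=
  n%:R^-1 * \sum_(i < n) (\1_A (tnth y i) - fine (F A)).

Let nR : n%:R != 0 :> R. Proof. by rewrite pnatr_eq0 -lt0n. Qed.

Lemma emp_devE y A :
  emp_dev y A = n%:R^-1 * (\sum_(i < n) \1_A (tnth y i)) - fine (F A).
Proof.
rewrite /emp_dev sumrB mulrBr sumr_const card_ord.
by rewrite -[fine _ *+ n]mulr_natl mulKf.
Qed.

Lemma emp_devU y A B : measurable A -> measurable B -> A `&` B = set0 ->
  emp_dev y (A `|` B) = emp_dev y A + emp_dev y B.
Proof.
move=> mA mB AB; rewrite /emp_dev -mulrDr -big_split/=; congr (_ * _).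
apply: eq_bigr => i _; rewrite measureU// fineD ?fin_num_measure//.
have : (tnth y i \in A) && (tnth y i \in B) = false by rewrite -in_setI AB in_set0.
by rewrite !indicE in_setU; case: (_ \in A); case: (_ \in B) => //= _; ring.
Qed.

Lemma emp_dev_ge y A : - fine (F A) <= emp_dev y A.
Proof.
rewrite emp_devE -[leLHS]add0r lerD2r mulr_ge0 ?invr_ge0//.
by apply: sumr_ge0 => i _; rewrite indicE.
Qed.

(** The maximal inequality for the complements of the growing sets I k; a set and its complement
    have opposite deviations. *)
Lemma emp_dev_maximal K (I : nat -> set T) (sigma : nat -> R) q :
  I 0%N = set0 -> (forall k, measurable (I k)) ->
  (forall k, I k `<=` I k.+1) ->
  (forall k, 0 < sigma k) -> (forall k, sigma k <= sigma k.+1) ->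
  (forall k, fine (F (I k.+1)) - fine (F (I k)) <= q) ->
  exists W : n.-tuple T -> R,
  [/\ measurable_fun setT W, forall y, 0 <= W y,
      forall k y, (k <= K)%N -> emp_dev y (I k) ^+ 2 <= sigma k ^+ 2 * W y
    & (\int[iid_law F n]_y (W y)%:E <=
       (64 * n%:R^-1 * (\sum_(l < K) q / sigma l.+1 ^+ 2))%:E)%E].
Proof.
move=> I0 mI Ind s0 snd Iq.
have DE k : fine (F (~` I k)) = 1 - fine (F (I k)).
  by rewrite probability_setC// fineB// fin_num_measure.
have [|||W [mW W0 Wk WI]] :=
  @iid_maximal_inequality _ _ _ F n K (fun k => ~` I k) sigma _ _ _ s0 snd.
- by rewrite I0 setC0.
- by move=> k; exact: measurableC.
- by move=> k; apply: subsetC; exact: Ind.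
exists (fun y => n%:R^-2 * W y); split.
- exact: measurable_funM.
- by move=> y; rewrite mulr_ge0.
- move=> k y kK; have := Wk k y kK; rewrite expr_div_n ler_pdivrMr ?exprn_gt0// => H.
  rewrite mulrCA /emp_dev exprMn exprVn ler_wpM2l// mulrC.
  move: H; congr (_ <= _).
  congr (_ ^+ 2); apply: eq_bigr => i _; rewrite DE !indicE in_setC.
  by case: (tnth y i \in I k) => /=; ring.
- under eq_integral do rewrite EFinM.
  have W0' y : [set: n.-tuple T] y -> (0%R <= (W y)%:E)%E by rewrite lee_fin.
  rewrite (ge0_integralZl _ _ _ W0') ?lee_fin//.
  + apply: (le_trans (lee_wpmul2l _ WI)); first by rewrite lee_fin.
    rewrite -EFinM lee_fin.
    rewrite (_ : _ * _ = 64 * n%:R^-1 * \sum_(l < K)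
        (fine (F (~` I l)) - fine (F (~` I l.+1))) / sigma l.+1 ^+ 2).
      rewrite ler_wpM2l ?mulr_ge0// ler_sum// => l _.
      rewrite ler_wpM2r ?invr_ge0 ?sqr_ge0//.
      by have := Iq l; rewrite !DE; lra.
    by field; rewrite nR.
  + exact/measurable_EFinP.
Qed.

End empirical_deviation.

(** Telescoping: m / (t + m)^2 <= m / (t (t + m)) = 1/t - 1/(t + m). *)
Lemma sum_inv_sqr_le (R : realFieldType) (m r : R) K : 0 < m -> 0 < r ->
  \sum_(l < K) m / (l.+1%:R * m + r) ^+ 2 <= r^-1.
Proof.
move=> m0 r0.
suff : \sum_(l < K) m / (l.+1%:R * m + r) ^+ 2 <= r^-1 - (K%:R * m + r)^-1.
  move/le_trans; apply; rewrite gerBl invr_ge0 addr_ge0 ?mulr_ge0//; exact: ltW.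
elim: K => [|K IH]; first by rewrite big_ord0 mul0r add0r subrr.
rewrite big_ord_recr/= (le_trans (lerD IH (lexx _)))//.
have t0 : 0 < K%:R * m + r by rewrite ltr_wpDl// mulr_ge0// ltW.
have -> : K.+1%:R * m + r = K%:R * m + r + m by rewrite -natr1; ring.
set t := K%:R * m + r in t0 *.
have tm0 : 0 < t + m by lra.
have : m / (t + m) ^+ 2 <= m / (t * (t + m)).
  rewrite ler_pM2l// lef_pV2 ?posrE ?exprn_gt0 ?mulr_gt0//.
  by rewrite expr2 ler_pM2r//; lra.
rewrite (_ : m / (t * (t + m)) = t^-1 - (t + m)^-1); first by lra.
by field; rewrite !gt_eqF.
Qed.

(** Chains c Z^2 G <= G^2 <= 3 (Z^2 A^2 + X^2 + M^2 r^4) and divides by c Z^2. The 9 is the square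
    of the 3 in s <= 3 Z, and r^4 <= r^2 Z^2 handles the last term. *)
Lemma regret_le (R : realFieldType) (c r M G Z A X s W : R) :
  0 < c -> 0 < r -> 0 <= M -> r < Z -> 0 < s -> s <= 3 * Z -> X ^+ 2 <= s ^+ 2 * W ->
  c * Z ^+ 2 <= G -> G <= Z * `|A| + `|X| + M * r ^+ 2 ->
  G <= 3 / c * (A ^+ 2 + 9 * W + M ^+ 2 * r ^+ 2).
Proof.
move=> c0 r0 M0 rZ s0 sZ XW Gc Gu.
have Z0 : 0 < Z by lra.
have Z2 : 0 < Z ^+ 2 by rewrite exprn_gt0.
have G0 : 0 <= G by rewrite (le_trans _ Gc)// mulr_ge0// ltW.
have W0 : 0 <= W.
  by rewrite -(pmulr_rge0 _ (_ : 0 < s ^+ 2)) ?exprn_gt0// (le_trans _ XW)// sqr_ge0.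
rewrite mulrAC ler_pdivlMr// -(ler_pM2r Z2).
set u := Z * `|A| + `|X| + M * r ^+ 2 in Gu.
have u2 : u ^+ 2 <= 3 * (Z ^+ 2 * A ^+ 2 + X ^+ 2 + (M * r ^+ 2) ^+ 2).
  rewrite -(real_normK (num_real A)) -(real_normK (num_real X)) /u.
  set a := Z * `|A|; set b := `|X|; set e := M * r ^+ 2.
  rewrite -exprMn -/a.
  have := sqr_ge0 (a - b); have := sqr_ge0 (b - e); have := sqr_ge0 (a - e); lra.
have G2 : G ^+ 2 <= u ^+ 2 by rewrite ler_pXn2r// nnegrE (le_trans G0).
have sW : s ^+ 2 * W <= 9 * Z ^+ 2 * W.
  rewrite ler_wpM2r//; have -> : 9 * Z ^+ 2 = (3 * Z) ^+ 2 by ring.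
  by rewrite ler_pXn2r// nnegrE; lra.
have rM : (M * r ^+ 2) ^+ 2 <= M ^+ 2 * r ^+ 2 * Z ^+ 2.
  have rZ2 : 0 <= Z ^+ 2 - r ^+ 2 by rewrite subr_ge0 ler_pXn2r// ?nnegrE; lra.
  by have := mulr_ge0 (mulr_ge0 (sqr_ge0 M) (sqr_ge0 r)) rZ2; lra.
have cG : c * Z ^+ 2 * G <= G ^+ 2 by rewrite expr2 ler_wpM2r.
lra.
Qed.

(** * Regret of the empirical price *)

Section mean_le.
Context d (T : measurableType d) (R : realType) (P : probability T R).
Implicit Types X Y : T -> R.

Definition mean_le X (b : R) : Prop :=
  [/\ measurable_fun setT X, forall y, 0 <= X y & (\int[P]_y (X y)%:E <= b%:E)%E].

Lemma mean_le_cst b : 0 <= b -> mean_le (fun=> b) b.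
Proof.
by move=> b0; split=> //; rewrite integral_cst// [X in (_ * X)%E]probability_setT mule1.
Qed.

Lemma mean_leD X Y a b : mean_le X a -> mean_le Y b ->
  mean_le (fun y => X y + Y y) (a + b).
Proof.
move=> [mX X0 Xa] [mY Y0 Yb]; split; first exact: measurable_funD.
  by move=> y; rewrite addr_ge0.
under eq_integral do rewrite EFinD.
have X0' y : [set: T] y -> (0 <= (X y)%:E)%E by rewrite lee_fin.
have Y0' y : [set: T] y -> (0 <= (Y y)%:E)%E by rewrite lee_fin.
rewrite (ge0_integralD _ _ X0' _ Y0')//; try exact/measurable_EFinP.
by rewrite EFinD leeD.
Qed.

Lemma mean_leZ X a c : 0 <= c -> mean_le X a -> mean_le (fun y => c * X y) (c * a).
Proof.
move=> c0 [mX X0 Xa]; split; first exact: measurable_funM.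
  by move=> y; rewrite mulr_ge0.
under eq_integral do rewrite EFinM.
have X0' y : [set: T] y -> (0 <= (X y)%:E)%E by rewrite lee_fin.
rewrite (ge0_integralZl _ _ _ X0') ?lee_fin//; last exact/measurable_EFinP.
by rewrite EFinM lee_wpmul2l// lee_fin.
Qed.

Lemma le_mean_le X a b : a <= b -> mean_le X a -> mean_le X b.
Proof.
by move=> ab [mX X0 Xa]; split=> //; rewrite (le_trans Xa)// lee_fin.
Qed.

End mean_le.

(** The pointwise bound is required only on a full-measure event. Truncating [X] at 0 changes it on
    a null set and reduces everything to nonnegative integrals; an infinite mean makes the claim
    trivial. *)
Lemma sub_expectation_le d (T : measurableType d) (R : realType)
    (P : probability T R) (X W : T -> R) (G : set T) c b :
  measurable_fun setT X -> mean_le P W b ->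
  measurable G -> P G = 1%E -> 0 <= c ->
  (forall y, G y -> 0 <= X y /\ c - X y <= W y) ->
  (c%:E - 'E_P[X] <= b%:E)%E.
Proof.
move=> mX [mW W0 Wb] mG PG c0 XW; rewrite unlock.
have PG0 : P (~` G) = 0%E by rewrite probability_setC// PG subee.
pose X' y := Num.max (X y) 0.
have mX' : measurable_fun setT X' by exact: measurable_maxr.
have X'0 y : 0 <= X' y by rewrite le_max lexx orbT.
have XX' y : G y -> X' y = X y by move=> /XW[? _]; apply/max_idPl.
have -> : (\int[P]_y (X y)%:E = \int[P]_y (X' y)%:E)%E.
  apply: ae_eq_integral => //; try exact/measurable_EFinP.
  exists (~` G); split => //; first exact: measurableC.
  by apply: subsetC => y Gy _ /=; rewrite XX'.
have : (c%:E <= \int[P]_y (X' y)%:E + \int[P]_y (W y)%:E)%E.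
  rewrite -ge0_integralD//; try exact/measurable_EFinP; last 2 first.
  - by move=> y _; rewrite lee_fin.
  - by move=> y _; rewrite lee_fin.
  have -> : (c%:E = \int[P]_y c%:E)%E.
    by rewrite integral_cst// [X in (_ * X)%E]probability_setT mule1.
  apply: ae_ge0_le_integral => //.
  - by move=> y _; rewrite adde_ge0// lee_fin.
  - by apply: emeasurable_funD; exact/measurable_EFinP.
  exists (~` G); split => //; first exact: measurableC.
  apply: subsetC => y Gy _ /=; rewrite lee_fin XX'//.
  by have [_] := XW _ Gy; lra.
move/le_trans/(_ (leeD2l _ Wb)).
have : (0 <= \int[P]_y (X' y)%:E)%E.
  by apply: integral_ge0 => y _; rewrite lee_fin.
case: (\int[P]_y _)%E => [x _||]//=; first by rewrite !lee_fin; lra.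
by move=> _ _; rewrite addeNy leNye.
Qed.

Lemma emp_dev_itv (R : realType) (F : probability (measurableTypeR R) R) n
    (y : n.-tuple (measurableTypeR R)) (a b : R) (e : itv_bound R) :
  (0 < n)%N -> a <= b -> (BLeft b <= e)%O ->
  emp_dev F y [set` Interval (BLeft a) e] =
  emp_dev F y `[a, b[%classic + emp_dev F y [set` Interval (BLeft b) e].
Proof.
move=> n0 ab be; rewrite -emp_devU//; last first.
  apply/seteqP; split=> z //= -[]; rewrite !itv_boundlr !bnd_simp.
  by move=> /andP[_ zb] /andP[bz _]; move: (lt_le_trans zb bz); rewrite ltxx.
by rewrite -itv_bndbnd_setU.
Qed.

Lemma empirical_revenueE (R : realType) (F : probability (measurableTypeR R) R) n
    (y : n.-tuple (measurableTypeR R)) p : (0 < n)%N ->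
  empirical_revenue y p =
  p * (emp_dev F y `[p, +oo[%classic + fine (F `[p, +oo[%classic)).
Proof.
move=> n0; rewrite emp_devE// subrK /empirical_revenue; congr (_ * (_ * _)).
rewrite -sum1_card natr_sum big_mkcond/=; apply: eq_bigr => i _.
by rewrite indicE mem_setE inE/= in_itv/= andbT; case: ifP.
Qed.

Section erm_regret.
Context {R : realType} (F : probability (measurableTypeR R) R) (f : R -> R).
Context (C0 Cstar Cbar pU : R).
Hypothesis C0_gt0 : 0 < C0.
Hypothesis Cstar_gt0 : 0 < Cstar.
Hypothesis Ff : has_density01 F f.
Hypothesis regF : regular C0 Cstar Cbar F f pU.
Hypothesis pU_max : maximizes01 (revenue F) pU.

Local Notation M := (1 + C0).

Let upper := revenue_upper C0_gt0 Ff regF pU_max.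
Let lower := revenue_lower C0_gt0 Cstar_gt0 Ff regF pU_max.
Let itv_le := prob_itv_le C0_gt0 Ff regF.

Let pU01 : 0 <= pU <= 1.
Proof. by case: pU_max => + _; rewrite in_itv. Qed.

Lemma prob_itvco_split a b c : a <= b -> b <= c ->
  fine (F `[a, c[%classic) = fine (F `[a, b[%classic) + fine (F `[b, c[%classic).
Proof.
move=> ab bc; rewrite (@itv_bndbnd_setU _ _ _ (BLeft b))//.
rewrite measureU// ?fineD ?fin_num_measure//.
apply/seteqP; split=> z //= -[]; rewrite !in_itv/= => /andP[_ zb] /andP[bz _].
by move: (lt_le_trans zb bz); rewrite ltxx.
Qed.

Lemma measurable_revenue : measurable_fun setT (revenue F).
Proof.
apply: measurable_funM => //; apply: measurable_funB => //.
apply: nondecreasing_measurable => // x y xy.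
by rewrite -subr_ge0 cdfB//; exact: fine_ge0.
Qed.

Lemma iid_law_01 n :
  iid_law F n [set y | forall i, tnth y i \in `[0, 1]] = 1%E.
Proof.
rewrite (iid_law_box F (A := fun=> `[0, 1]%classic))// big1// => i _.
rewrite -[`[0, 1]%classic]setCK probability_setC; last exact: measurableC.
by rewrite (prob_ae_01 Ff) sube0.
Qed.

Lemma measurable_sample01 n :
  measurable [set y : n.-tuple (measurableTypeR R) | forall i, tnth y i \in `[0, 1]].
Proof.
rewrite (_ : [set _ | _] = \bigcap_(i in [set: 'I_n])
    ((@tnth _ (measurableTypeR R) ^~ i) @^-1` `[0, 1]%classic)); last first.
  by apply/seteqP; split=> x /= H i; [move=> _; exact: H|exact: H].
apply: fin_bigcap_measurable => // i _.
by rewrite -[X in measurable X]setTI; exact: measurable_tnth.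
Qed.

Section sample.
Context (n : nat) (n_gt0 : (0 < n)%N) (y : n.-tuple (measurableTypeR R)) (p : R).
Hypothesis p_erm : maximizes01 (empirical_revenue y) p.

Let p01 : 0 <= p <= 1.
Proof. by case: p_erm => + _; rewrite in_itv. Qed.

(** Empirical revenue is true revenue plus price times deviation, and [p] beats [pU] empirically. *)
Lemma regret_le_dev : revenue F pU - revenue F p <=
  p * emp_dev F y `[p, +oo[%classic - pU * emp_dev F y `[pU, +oo[%classic.
Proof.
case: p_erm => _ /(_ pU); rewrite in_itv/= => /(_ pU01).
rewrite !(empirical_revenueE F)// !(revenueE C0_gt0 Ff regF); lra.
Qed.

Let A := emp_dev F y `[pU, +oo[%classic.

(** The grid point pU + s lies below [p], so the deviation D on the gap enters as - p D and is
    bounded by the true mass of the gap, as empirical mass is nonnegative. *)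
Lemma regret_le_dev_right m s : 0 <= s -> 0 <= m -> pU + s <= p -> p <= pU + s + m ->
  revenue F pU - revenue F p <=
  (p - pU) * `|A| + `|emp_dev F y `[pU, pU + s[%classic| + M * m.
Proof.
move=> s0 m0 sp pm; apply: (le_trans regret_le_dev).
have /andP[p0 p1] := p01.
have := @emp_dev_itv _ F n y pU p +oo%O n_gt0 ltac:(lra) isT.
have := @emp_dev_itv _ F n y pU (pU + s) (BLeft p) n_gt0 ltac:(lra) sp.
have := emp_dev_ge F n_gt0 y `[pU + s, p[%classic.
have := itv_le true true sp.
rewrite -/A; set X := emp_dev F y `[pU, pU + s[%classic.
set P := fine _; set D := emp_dev F y `[pU + s, p[%classic.
set E := emp_dev F y `[pU, p[%classic; set B := emp_dev F y `[p, +oo[%classic.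
move=> Pm PD EX AE.
have Mm : M * (p - (pU + s)) <= M * m by rewrite ler_wpM2l; move: C0_gt0; lra.
have : (p - pU) * A <= (p - pU) * `|A| by rewrite ler_wpM2l ?ler_norm//; lra.
have : p * - X <= `|X|.
  rewrite (le_trans (ler_norm _))// normrM normrN ger0_norm// ler_piMl//.
have : p * - D <= M * m.
  have P0 : 0 <= P by exact: fine_ge0.
  have := mulr_ge0 p0 (_ : 0 <= P + D); have := ler_piMl P0 p1.
  by move=> pP /(_ ltac:(lra)); lra.
rewrite (_ : B = A - X - D); last by lra.
lra.
Qed.

(** The grid point is again taken below [p], now on the far side from [pU], so that the gap keeps
    its favorable sign. *)
Lemma regret_le_dev_left m s : 0 <= m -> pU - s <= p -> p <= pU - s + m -> p <= pU ->
  revenue F pU - revenue F p <=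
  (pU - p) * `|A| + `|emp_dev F y `[pU - s, pU[%classic| + M * m.
Proof.
move=> m0 sp pm ppU; apply: (le_trans regret_le_dev).
have /andP[p0 p1] := p01.
have := @emp_dev_itv _ F n y p pU +oo%O n_gt0 ltac:(lra) isT.
have := @emp_dev_itv _ F n y (pU - s) p (BLeft pU) n_gt0 sp ppU.
have := emp_dev_ge F n_gt0 y `[pU - s, p[%classic.
have := itv_le true true sp.
rewrite -/A; set X := emp_dev F y `[pU - s, pU[%classic.
set P := fine _; set D := emp_dev F y `[pU - s, p[%classic.
set E := emp_dev F y `[p, pU[%classic; set B := emp_dev F y `[p, +oo[%classic.
move=> Pm PD EX AE.
have Mm : M * (p - (pU - s)) <= M * m by rewrite ler_wpM2l; move: C0_gt0; lra.
have : (pU - p) * - A <= (pU - p) * `|A|.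
  by rewrite ler_wpM2l ?subr_ge0// -normrN ler_norm.
have : p * X <= `|X|.
  by rewrite (le_trans (ler_norm _))// normrM ger0_norm// ler_piMl.
have : p * - D <= M * m.
  have P0 : 0 <= P by exact: fine_ge0.
  have := mulr_ge0 p0 (_ : 0 <= P + D); have := ler_piMl P0 p1.
  by move=> pP /(_ ltac:(lra)); lra.
rewrite (_ : B = X - D + A); last by lra.
lra.
Qed.

End sample.

Lemma regret_le_maximal n (y : n.-tuple (measurableTypeR R)) p r K (WA WR WL : R) :
  (0 < n)%N -> maximizes01 (empirical_revenue y) p ->
  0 < r <= 1 -> (r ^+ 2)^-1 < K%:R ->
  emp_dev F y `[pU, +oo[%classic ^+ 2 <= WA ->
  (forall k, (k <= K)%N ->
    emp_dev F y `[pU, pU + k%:R * r ^+ 2[%classic ^+ 2 <=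
    (k%:R * r ^+ 2 + r) ^+ 2 * WR) ->
  (forall k, (k <= K)%N ->
    emp_dev F y `[pU - k%:R * r ^+ 2, pU[%classic ^+ 2 <=
    (k%:R * r ^+ 2 + r) ^+ 2 * WL) ->
  revenue F pU - revenue F p <= (3 * M + 2 * C0) * r ^+ 2 +
    3 / (Cstar / 2) * (WA + 9 * (WR + WL) + M ^+ 2 * r ^+ 2).
Proof.
move=> n0 erm /andP[r0 r1] rK HA HR HL.
have p01 : p \in `[0, 1] by case: erm.
have /andP[p0 p1] : 0 <= p <= 1 by move: p01; rewrite in_itv.
have /andP[pU0 pU1] := pU01.
have M0 : 0 <= M by move: C0_gt0; lra.
have L0 : 0 <= 3 * M + 2 * C0 by move: C0_gt0; lra.
have c0 : 0 < Cstar / 2 by rewrite divr_gt0.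
have c3 : 0 <= 3 / (Cstar / 2) by rewrite divr_ge0// ltW.
set m := r ^+ 2 in rK HR HL *; have m0 : 0 < m by rewrite exprn_gt0.
have mr : m <= r by rewrite /m expr2 ler_piMl// ltW.
have sig0 k : 0 < k%:R * m + r by rewrite ltr_wpDl// mulr_ge0// ltW.
have W0 k X W : X ^+ 2 <= (k%:R * m + r) ^+ 2 * W -> 0 <= W.
  move=> H; rewrite -(pmulr_rge0 _ (_ : 0 < (k%:R * m + r) ^+ 2)) ?exprn_gt0//.
  by rewrite (le_trans _ H)// sqr_ge0.
have WR0 := W0 _ _ _ (HR 0%N (leq0n K)).
have WL0 := W0 _ _ _ (HL 0%N (leq0n K)).
have WA0 : 0 <= WA by rewrite (le_trans _ HA)// sqr_ge0.
have Mm0 : 0 <= M ^+ 2 * m by rewrite mulr_ge0 ?sqr_ge0// ltW.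
(* Index of the grid cell containing a distance Z; it stays below K because Z <= 1 and 1 / m < K. *)
have trunc Z : 0 <= Z <= 1 -> let k := Num.truncn (Z / m) in
    k%:R * m <= Z < k.+1%:R * m /\ (k < K)%N.
  move=> /andP[Z0 Z1] k.
  have Zm : 0 <= Z / m by rewrite divr_ge0// ltW.
  have /andP[k0 k1] := truncn_itv Zm.
  split; first by rewrite -ler_pdivlMr// -ltr_pdivrMr// k0 k1.
  rewrite -(ltr_nat R) (le_lt_trans k0)// (le_lt_trans _ rK)//.
  by rewrite ler_piMl// invr_ge0 ltW.
have low := lower p01.
have [Zr|rZ] := leP `|p - pU| r.
  apply: (le_trans (upper p01)); rewrite -[leLHS]addr0 lerD//.
    rewrite ler_wpM2l// /m -(real_normK (num_real (p - pU))).
    by rewrite ler_pXn2r// nnegrE// ltW.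
  by rewrite mulr_ge0// !addr_ge0// mulr_ge0// addr_ge0.
have fin A X s W : X ^+ 2 <= s ^+ 2 * W -> 0 < s -> s <= 3 * `|p - pU| ->
    A ^+ 2 <= WA -> W <= WR + WL ->
    revenue F pU - revenue F p <= `|p - pU| * `|A| + `|X| + M * m ->
    revenue F pU - revenue F p <= (3 * M + 2 * C0) * m +
      3 / (Cstar / 2) * (WA + 9 * (WR + WL) + M ^+ 2 * m).
  move=> XW s0 sZ AW WW Gu.
  rewrite -(real_normK (num_real (p - pU))) in low.
  have := @regret_le _ _ _ _ _ _ A _ _ _ c0 r0 M0 rZ s0 sZ XW low Gu.
  move/le_trans; apply; rewrite -[leLHS]add0r; apply: lerD.
    by rewrite mulr_ge0// ltW.
  by rewrite ler_wpM2l// -/m; lra.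
have [pUp|/ltW ppU] := leP pU p.
  move: rZ fin; rewrite ger0_norm ?subr_ge0// => rZ fin.
  have [|/andP[kZ Zk] kK] := trunc (p - pU); first by apply/andP; lra.
  set k := Num.truncn _ in kZ Zk kK.
  apply: (fin (emp_dev F y `[pU, +oo[%classic) _ _ _ (HR k (ltnW kK))) => //.
  - lra.
  - lra.
  - have k0 : 0 <= k%:R * m by rewrite mulr_ge0// ltW.
    apply: regret_le_dev_right => //; [exact: ltW|lra|].
    by move: Zk; rewrite -natr1; lra.
move: rZ fin; rewrite distrC ger0_norm ?subr_ge0// => rZ fin.
have [|/andP[kZ Zk] kK] := trunc (pU - p); first by apply/andP; lra.
set k := Num.truncn _ in kZ Zk kK.
(* Index k+1 rounds away from [pU]. Then (k + 1) m + r <= Z + m + r <= 3 Z, which is where the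
   factor 3 comes from. *)
apply: (fin (emp_dev F y `[pU, +oo[%classic) _ _ _ (HL k.+1 kK)) => //.
- by rewrite -natr1; lra.
- lra.
- apply: regret_le_dev_left => //; [exact: ltW|lra|].
  by rewrite -natr1; lra.
Qed.

Lemma erm_regret_le n (phat : n.-tuple (measurableTypeR R) -> R) :
  (0 < n)%N -> erm_price phat ->
  ((revenue F pU)%:E - 'E_(iid_law F n)[fun y => revenue F (phat y)] <=
   ((3 * M + 2 * C0 + 3 / (Cstar / 2) * (64 + 1152 * M + M ^+ 2))
    * n%:R `^ (- (2 / 3)))%:E)%E.
Proof.
move=> n0 [mphat phat_max].
have n1 : 1 <= n%:R :> R by rewrite ler1n.
have M0 : 0 <= M by move: C0_gt0; lra.
have c3 : 0 <= 3 / (Cstar / 2) by rewrite divr_ge0// divr_ge0// ltW.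
pose r : R := n%:R `^ (- (1 / 3)).
have r0 : 0 < r by rewrite powR_gt0// ltr0n.
have r2 : n%:R `^ (- (2 / 3)) = r ^+ 2.
  by rewrite /r -powR_mulrn ?ltW// -powRrM; congr (_ `^ _); field.
have r3 : n%:R^-1 = r ^+ 3.
  rewrite /r -powR_mulrn ?ltW// -powRrM -[n%:R^-1]powR_inv1 ?ler0n//.
  by congr (_ `^ _); field.
have r1 : r <= 1.
  rewrite leNgt; apply/negP => r1.
  have : n%:R^-1 <= 1 :> R by rewrite invf_le1// ltr0n.
  by rewrite r3 leNgt exprn_egt1.
rewrite r2; set m := r ^+ 2.
have m0 : 0 < m by rewrite exprn_gt0.
(* Enough grid steps of length m to cover a unit distance. *)
pose K := (Num.truncn m^-1).+1.
have mK : m^-1 < K%:R by exact: truncnS_gt.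
pose sigma k := k%:R * m + r.
have s0 k : 0 < sigma k by rewrite ltr_wpDl// mulr_ge0// ltW.
have snd k : sigma k <= sigma k.+1 by rewrite /sigma -natr1; lra.
(* A one-step family: the maximal inequality with K = 1 and unit weights yields the second moment of
   a single deviation. *)
pose IA k := if k is 0%N then set0 else `[pU, +oo[%classic : set (measurableTypeR R).
pose IR k := `[pU, pU + k%:R * m[%classic : set (measurableTypeR R).
pose IL k := `[pU - k%:R * m, pU[%classic : set (measurableTypeR R).
have [|||WA [mWA WA0 WAk WAI]] :=
  @emp_dev_maximal _ _ _ F n n0 1 IA (fun=> 1) 1 erefl _ _ (fun=> ltr01) (fun=> lexx _) _.
- by case=> [|k] /=; [exact: measurable0|exact: measurable_itv].
- by case=> [|k] z.
- case=> [|k] /=; last by rewrite subrr.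
  by rewrite measure0 subr0 -lee_fin fineK ?fin_num_measure// probability_le1.
have km k : 0 <= k%:R * m by rewrite mulr_ge0// ltW.
have [||||WR [mWR WR0 WRk WRI]] :=
  @emp_dev_maximal _ _ _ F n n0 K IR sigma (M * m) _ _ _ s0 snd _.
- by rewrite /IR mul0r addr0 set_itvco0.
- by move=> k; exact: measurable_itv.
- by move=> k z; rewrite /IR /= !in_itv/= -natr1 => /andP[->]; lra.
- move=> k; rewrite /IR (@prob_itvco_split _ (pU + k%:R * m)) -?natr1;
    [|by have := km k; lra|lra].
  rewrite addrAC subrr add0r (le_trans (itv_le _ _ _)); lra.
have [||||WL [mWL WL0 WLk WLI]] :=
  @emp_dev_maximal _ _ _ F n n0 K IL sigma (M * m) _ _ _ s0 snd _.
- by rewrite /IL mul0r subr0 set_itvco0.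
- by move=> k; exact: measurable_itv.
- move=> k z; rewrite /IL /= !in_itv/= -natr1 => /andP[? ->]; lra.
- move=> k; rewrite /IL (@prob_itvco_split _ (pU - k%:R * m)) -?natr1;
    [|lra|by have := km k; lra].
  rewrite addrK (le_trans (itv_le _ _ _)); lra.
pose W y := (3 * M + 2 * C0) * m +
    3 / (Cstar / 2) * (WA y + 9 * (WR y + WL y) + M ^+ 2 * m).
have pU_ge0 : 0 <= pU by case/andP: pU01.
apply: (@sub_expectation_le _ _ _ _ _ W _ _ _ _ _
  (@measurable_sample01 n) (@iid_law_01 n)).
- exact: measurableT_comp measurable_revenue _.
- have nm : n%:R^-1 <= m by rewrite r3 /m exprSr ler_piMr// ltW.
  have MA : mean_le (iid_law F n) WA (64 * m).
    split=> //; apply: (le_trans WAI); rewrite lee_fin big_ord1 expr1n divr1 mulr1.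
    by rewrite ler_wpM2l.
  (* Here 64 / n times M / r is 64 M r^2. Two such terms with factor 9 produce the 1152 M of the
     final constant. *)
  have MW (V : n.-tuple (measurableTypeR R) -> R) :
      measurable_fun setT V -> (forall y, 0 <= V y) ->
      (\int[iid_law F n]_y (V y)%:E <=
        (64 * n%:R^-1 * (\sum_(l < K) M * m / sigma l.+1 ^+ 2))%:E)%E ->
      mean_le (iid_law F n) V (64 * (M * m)).
    move=> mV V0 VI; split=> //; apply: (le_trans VI).
    rewrite lee_fin -mulrA ler_wpM2l//; under eq_bigr do rewrite -mulrA.
    rewrite -mulr_sumr mulrCA ler_wpM2l//.
    have := @sum_inv_sqr_le _ m r K m0 r0 => S.
    rewrite (le_trans (ler_wpM2l _ S)) ?invr_ge0// r3 exprSr mulfK// gt_eqF//.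
  have [L0 M2] : 0 <= (3 * M + 2 * C0) * m /\ 0 <= M ^+ 2 * m.
    split; apply: mulr_ge0; rewrite ?sqr_ge0 ?(ltW m0)//.
    by move: C0_gt0; lra.
  have [MR ML] := (MW _ mWR WR0 WRI, MW _ mWL WL0 WLI).
  have nine : 0 <= 9 :> R by [].
  have := mean_leD (mean_le_cst (iid_law F n) L0) (mean_leZ c3 (mean_leD (mean_leD MA
    (mean_leZ nine (mean_leD MR ML))) (mean_le_cst (iid_law F n) M2))).
  apply: le_mean_le; set q := 3 / _; lra.
- exact: revenue_ge0.
- move=> y /phat_max erm; split.
    by apply: revenue_ge0; case: erm => + _; rewrite in_itv => /andP[].
  apply: (@regret_le_maximal n y (phat y) r K) => //.
  + by rewrite r0.
  + by have := WAk 1%N y (leqnn _); rewrite expr1n mul1r.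
  + by move=> k kK; exact: WRk.
  + by move=> k kK; exact: WLk.
Qed.

End erm_regret.

Theorem corollary1 (R : realType) (C0 Cstar Cbar : R)
    (FU : set (probability (measurableTypeR R) R))
    (pU : probability (measurableTypeR R) R -> R)
    (phat : forall n : nat, n.-tuple (measurableTypeR R) -> R)
    (C0_gt0 : 0 < C0) (Cstar_gt0 : 0 < Cstar) (Cbar_gt0 : 0 < Cbar)
    (pU_max : forall F, FU F -> maximizes01 (revenue F) (pU F))
    (FU_regular : forall F, FU F ->
      exists f : R -> R,
        has_density01 F f /\ regular C0 Cstar Cbar F f (pU F))
    (phat_erm : forall n : nat, (0 < n)%N -> erm_price (@phat n)) :
  exists C : R, forall n : nat, (0 < n)%N ->
    (ereal_sup [set (revenue F (pU F))%:E
                    - 'E_(iid_law F n)[fun y => revenue F (phat n y)] | F in FU]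
     <= (C * n%:R `^ (- (2 / 3)))%:E)%E.
Proof.
(* The witness is the constant of [erm_regret_le], an expression in C0 and Cstar, hence common to
   all n and all laws of the class. *)
eexists => n n0; apply: ge_ereal_sup => _ [F FUF <-].
have [f [Ff regF]] := FU_regular F FUF.
exact: (erm_regret_le C0_gt0 Cstar_gt0 Ff regF (pU_max F FUF) n0 (phat_erm n n0)).
Qed.
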